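(* Let $k\ge0$ and $n\ge k+2$ be integers, consider evenly spaced inputs $x_i=i/n$, $i=1,\ldots,n$, and let $G,H\in\mathbb{R}^{n\times n}$ be the locally adaptive regression spline and trend filtering basis matrices of order $k$ (defined in the context). (a) If $k=0$ or $k=1$, then $G=H$, so the lasso representations for locally adaptive regression splines and trend filtering, $$\min_{\theta\in\mathbb{R}^n}\tfrac12\|y-G\theta\|_2^2+\lambda\sum_{j=k+2}^n|\theta_j|\qquad\text{and}\qquad\min_{\alpha\in\mathbb{R}^n}\tfrac12\|y-H\alpha\|_2^2+\lambda\sum_{j=k+2}^n|\alpha_j|,$$ are the same. Therefore their solutions are the same, or in other words, $$\hat\beta_i=\hat f(x_i)\qquad\text{for } i=1,\ldots,n,$$ where $\hat\beta$ and $\hat f$ are the solutions of the original $k$th order trend filtering and locally adaptive regression spline problems, at any fixed common value of the tuning parameter $\lambda$. (b) If $k\ge2$, however, then $G\ne H$, so the two lasso problems displayed in (a) (with this $k$) are different, and hence the trend filtering and locally adaptive regression spline estimators are generically different.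
   Context: Here $y\in\mathbb{R}^n$ is the vector of observations and $\lambda\ge0$ is the tuning parameter. Matrix $G$ (evaluations of the $k$th order truncated power basis at the inputs): for $k=0$, $G_{ij}=0$ if $i<j$ and $G_{ij}=1$ if $i\ge j$. For $k>0$ even: $G_{ij}=i^{j-1}/n^{j-1}$ for $1\le i\le n$, $1\le j\le k+1$; for $j\ge k+2$, $G_{ij}=0$ if $i\le j-k/2$ and $G_{ij}=(i-j+k/2)^k/n^k$ if $i>j-k/2$. For $k>0$ odd: $G_{ij}=i^{j-1}/n^{j-1}$ for $1\le i\le n$, $1\le j\le k+1$; for $j\ge k+2$, $G_{ij}=0$ if $i\le j-(k+1)/2$ and $G_{ij}=(i-j+(k+1)/2)^k/n^k$ if $i>j-(k+1)/2$. Matrix $H$: $H_{ij}=i^{j-1}/n^{j-1}$ for $1\le i\le n$, $1\le j\le k+1$; for $j\ge k+2$, $H_{ij}=0$ if $i\le j-1$ and $H_{ij}=\sigma^{(k)}_{i-j+1}\cdot k!/n^k$ if $i>j-1$, where $\sigma_i^{(0)}=1$ for all $i$ and $\sigma_i^{(k)}=\sum_{j=1}^i\sigma_j^{(k-1)}$ for $k\ge1$. Trend filtering: the discrete difference operators are defined by $D^{(1)}$ with $(D^{(1)}\beta)_i=\beta_{i+1}-\beta_i$ (of size $(m-1)\times m$ when acting on $\mathbb{R}^m$), and recursively $D^{(k+1)}=D^{(1)}D^{(k)}\in\mathbb{R}^{(n-k-1)\times n}$. The $k$th order trend filtering estimate is the unique minimizer $\hat\beta=\operatorname{argmin}_{\beta\in\mathbb{R}^n}\tfrac12\|y-\beta\|_2^2+\frac{n^k}{k!}\lambda\|D^{(k+1)}\beta\|_1$.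 Locally adaptive regression splines: let $T=\{x_{k/2+2},\ldots,x_{n-k/2}\}$ if $k$ is even and $T=\{x_{(k+1)/2+1},\ldots,x_{n-(k+1)/2}\}$ if $k$ is odd. Let $\mathcal{G}_k$ be the set of functions $f:[0,1]\to\mathbb{R}$ that are $k$th degree splines with knots contained in $T$ (piecewise polynomials of degree $k$ with continuous derivatives of orders $0,\ldots,k-1$ at the knots; $k$th derivatives, and the functions themselves when $k=0$, are taken right-continuous). With $f^{(k)}$ the $k$th weak derivative ($f^{(0)}=f$) and $\mathrm{TV}$ the total variation on $[0,1]$, the $k$th order locally adaptive regression spline estimate is $\hat f=\operatorname{argmin}_{f\in\mathcal{G}_k}\tfrac12\sum_{i=1}^n(y_i-f(x_i))^2+\lambda\,\mathrm{TV}(f^{(k)})$. *)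

(* Defs.v *)
From mathcomp Require Export all_boot all_order all_algebra.
From mathcomp Require Export all_classical all_reals all_analysis.

Set Implicit Arguments.
Unset Strict Implicit.
Unset Printing Implicit Defensive.

Export Order.TTheory GRing.Theory Num.Theory numFieldNormedType.Exports.

Open Scope classical_set_scope.
Open Scope ring_scope.

Definition argmin {T : Type} {d : Order.disp_t} {V : porderType d}
    (A : set T) (F : T -> V) : set T :=
  [set t | A t /\ forall s, A s -> (F t <= F s)%O].

Definition input (R : realType) (n i : nat) : R := i%:R / n%:R.

(* In the two families of entries below, rows and columns are numbered from 1;
   the shift to ordinals takes place in lars_basis and tf_basis. *)
Definition lars_entry (R : realType) (k n i j : nat) : R :=
  if k == 0%N then (if (i < j)%N then 0 else 1)
  else if (j <= k.+1)%N then i%:R ^+ (j - 1) / n%:R ^+ (j - 1)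
  else if ~~ odd k then
    if (i <= j - k./2)%N then 0
    else (i%:R - j%:R + k./2%:R) ^+ k / n%:R ^+ k
  else
    if (i <= j - k.+1./2)%N then 0
    else (i%:R - j%:R + k.+1./2%:R) ^+ k / n%:R ^+ k.

Fixpoint sigma (k i : nat) : nat :=
  if k is k'.+1 then (\sum_(1 <= j < i.+1) sigma k' j)%N else 1%N.

Definition tf_entry (R : realType) (k n i j : nat) : R :=
  if (j <= k.+1)%N then i%:R ^+ (j - 1) / n%:R ^+ (j - 1)
  else if (i <= j - 1)%N then 0
  else (sigma k (i - j + 1))%:R * k`!%:R / n%:R ^+ k.

Definition lars_basis (R : realType) (k n : nat) : 'M[R]_n :=
  \matrix_(i, j) lars_entry R k n i.+1 j.+1.

Definition tf_basis (R : realType) (k n : nat) : 'M[R]_n :=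
  \matrix_(i, j) tf_entry R k n i.+1 j.+1.

(* The penalized coordinates j >= k+2 are the ordinals j > k. *)
Definition lasso_obj (R : realType) (k n : nat) (X : 'M[R]_n) (y : 'cV[R]_n)
    (lambda : R) (theta : 'cV[R]_n) : R :=
  2^-1 * (\sum_i (y i 0 - (X *m theta) i 0) ^+ 2)
  + lambda * \sum_(j < n | (k < j)%N) `|theta j 0|.

Definition diff1 (R : realType) (m : nat) : 'M[R]_(m.-1, m) :=
  \matrix_(i < m.-1, j < m)
    ((j == i.+1 :> nat)%:R - (j == i :> nat)%:R).

(* The number of rows, iter k predn n, is n - k; in this form the recursion
   needs no cast. *)
Fixpoint diffop (R : realType) (n k : nat) : 'M[R]_(iter k predn n, n) :=
  match k return 'M[R]_(iter k predn n, n) with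
  | 0%N => 1%:M
  | k'.+1 => diff1 R (iter k' predn n) *m diffop R n k'
  end.

Definition tf_obj (R : realType) (k n : nat) (y : 'cV[R]_n) (lambda : R)
    (beta : 'cV[R]_n) : R :=
  2^-1 * (\sum_i (y i 0 - beta i 0) ^+ 2)
  + n%:R ^+ k / k`!%:R * lambda * \sum_i `|(diffop R n k.+1 *m beta) i 0|.

Definition tf_estimate (R : realType) (k n : nat) (y : 'cV[R]_n) (lambda : R)
  : set 'cV[R]_n := argmin setT (tf_obj k y lambda).

(* A function on [0, 1] is represented by a total function on R: nothing below
   depends on its values outside [0, 1]. *)

Definition knots (R : realType) (k n : nat) : seq R :=
  if ~~ odd k then
    [seq input R n i | i <- index_iota (k./2 + 2) (n - k./2).+1]
  else
    [seq input R n i | i <- index_iota (k.+1./2 + 1) (n - k.+1./2).+1].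

(* The breakpoints t_0 < ... < t_(m-1) are all the elements of T; a spline with
   fewer knots has equal polynomials on both sides of the others. On [0, 1], f
   is p_l on the points x with exactly l breakpoints <= x, that is on
   [t_(l-1), t_l[: this makes f right-continuous when k = 0. *)
Definition splines (R : realType) (k : nat) (T : seq R) : set (R -> R) :=
  [set f | exists p : nat -> {poly R},
     [/\ forall l, (size (p l) <= k.+1)%N,
         forall l d, (l < size T)%N -> (d < k)%N ->
           (derivn d (p l)).[nth 0 T l] = (derivn d (p l.+1)).[nth 0 T l]
       & forall x, 0 <= x <= 1 -> f x = (p (count (fun t => t <= x) T)).[x]]].

(* The space C_c^oo(]0, 1[). *)
Definition test_function (R : realType) (phi : R -> R) : Prop :=
  (forall m x, derivable (derive1n m phi) x 1) /\
  (exists a b : R, [/\ 0 < a, b < 1 &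
     forall x, ~~ (a <= x <= b) -> phi x = 0]).

Definition weak_derivative (R : realType) (k : nat) (f g : R -> R) : Prop :=
  [/\ locally_integrable `]0, 1[ f, locally_integrable `]0, 1[ g &
      forall phi : R -> R, test_function phi ->
        \int[lebesgue_measure]_(x in `]0, 1[) (f x * derive1n k phi x) =
        (-1) ^+ k * \int[lebesgue_measure]_(x in `]0, 1[) (g x * phi x)].

(* f^(k): for k > 0, the weak derivative is determined only almost everywhere;
   its representative on [0, 1] is the right-continuous one, with its left limit
   as value at 1 (no jump is added at the endpoint, where right-continuity says
   nothing). It is unique on [0, 1] when it exists, as it does for a spline. *)
Definition kth_derivative (R : realType) (k : nat) (f : R -> R) : R -> R :=
  if k == 0%N then f else
  xget (fun=> 0) [set g : R -> R |
    [/\ weak_derivative k f g,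
        forall x, 0 <= x < 1 -> g z @[z --> x^'+] --> g x
      & g z @[z --> 1^'-] --> g 1]].

Definition lars_obj (R : realType) (k n : nat) (y : 'cV[R]_n) (lambda : R)
    (f : R -> R) : \bar R :=
  ((2^-1 * (\sum_(i < n) (y i 0 - f (input R n i.+1)) ^+ 2))%:E
   + lambda%:E * total_variation 0 1 (kth_derivative k f))%E.

Definition lars_estimate (R : realType) (k n : nat) (y : 'cV[R]_n) (lambda : R)
  : set (R -> R) := argmin (splines k (knots R k n)) (lars_obj k y lambda).

(* P holds outside a finite union of hyperplanes a^T y = 0, a != 0; the
   exceptional set is thus closed, nowhere dense and Lebesgue negligible. *)
Definition generically (R : realType) (n : nat) (P : 'cV[R]_n -> Prop) : Prop :=
  exists s : seq 'cV[R]_n, (forall a, a \in s -> a != 0) /\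
    forall y : 'cV[R]_n, (forall a, a \in s -> \sum_i a i 0 * y i 0 != 0) -> P y.

(* Main.v *)
From mathcomp Require Import zify ring lra measurable_realfun.
Require Import Defs.

Set Implicit Arguments.
Unset Strict Implicit.
Unset Printing Implicit Defensive.

(** Why it holds.

    Write [D] for the difference operator of order [k+1], [c] for [n^k / k!],
    and [q] for [ceil (k/2)], so that the last knot is [x_(n-q)].

    Both estimators are lasso problems.  The operator [D] kills the first [k+1]
    columns of [H] and maps the others to [1/c] times the standard basis
    ([diffop_tf_col]); [H] is invertible, since a polynomial of degree at most
    [k] has at most [k] roots ([tf_basis_inj]).  Hence trend filtering is exactly
    the lasso in the basis [H] ([tf_estimate_lasso]).  On the other side a spline
    is the sum of a polynomial and of multiples of [(x - t)_+^k], and the total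
    variation of its [k]th derivative is [k!] times the l1 norm of those
    multiples ([lars_obj_lasso]): the spline problem is the lasso in the basis
    [G] with tuning parameter [lambda k!] ([lars_estimate_lasso]).  For [k <= 1]
    we have [k! = 1] and [G = H], and the fit of a lasso is unique by strict
    convexity of the squared error ([lasso_fit_unique]): this is part (a).

    For [k >= 2] the point is the inequality [c |D g|_1 < 1] for the last column
    [g] of [G] ([lars_last_diff_lt1]): differencing the truncated power of order
    [k] gives Eulerian numbers, whose total is [k!], and the last knot is so
    close to the end that at most the first [q < k] of the [k] positive ones
    appear.  Stationarity of a trend filtering fit [beta] bounds its residual by
    [|<v, y - beta>| <= lambda c |D v|_1] for all [v] ([tf_residual]), so
    [|<g, y - beta>| < lambda].  If [beta = G theta] were a lasso fit at a tuning
    parameter at least [lambda], stationarity would force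
    [|<g, y - beta>| >= lambda] as soon as the last coordinate of [theta] is
    nonzero ([lasso_active]).  That coordinate is a linear functional
    [<a, beta>] of the fit, and [beta] tends to [y] as [lambda] tends to 0, so it
    is nonzero for small [lambda] unless [<a, y> = 0]: a single exceptional
    hyperplane suffices ([fits_differ]).  When [G] is singular, the same argument
    works with [a] orthogonal to the range of [G].

    The analytic part identifies the [k]th derivative of a spline.  That the
    piecewise constant function is a weak derivative is integration by parts on
    each half-line to the right of a knot ([weak_derivative_sum]); that no other
    function with the same one-sided continuity is one follows by testing against
    smooth bumps ([weak_eq_right_continuous]). *)

(** * Iterated forward differences *)

Definition fdiff (R : zmodType) (F : nat -> R) : nat -> R :=
  fun i => F i.+1 - F i.

Lemma eq_iter_fdiff (R : zmodType) N (F G : nat -> R) :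
  F =1 G -> iter N (@fdiff R) F =1 iter N (@fdiff R) G.
Proof. by move=> FG; elim: N => //= N IH i; rewrite /fdiff !IH. Qed.

Lemma iter_fdiff_scale (R : pzRingType) N (c : R) (F : nat -> R) i :
  iter N (@fdiff R) (fun i => c * F i) i = c * iter N (@fdiff R) F i.
Proof. by elim: N i => //= N IH i; rewrite /fdiff !IH mulrBr. Qed.

(** Differences of vectors become differences of sequences, which removes the
    dependent row count [iter N predn n] from every later computation. *)
Lemma diffop_fdiff (R : realType) N n (F : nat -> R) (v : 'cV[R]_n) :
  (forall j, v j 0 = F j) ->
  forall i, (diffop R n N *m v) i 0 = iter N (@fdiff R) F i.
Proof.
move=> vF; elim: N => [|N IH] i; first by rewrite mul1mx vF.
rewrite [diffop _ _ _]/= -mulmxA mxE.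
under eq_bigr => j _ do rewrite mxE IH mulrBl.
rewrite sumrB /= /fdiff.
have li : (i.+1 < iter N predn n)%N by have := ltn_ord i; rewrite /=; lia.
have li' : (i < iter N predn n)%N by lia.
rewrite (bigD1 (Ordinal li)) //= eqxx mul1r big1 => [|j ne]; last first.
  have /negPf -> : j != i.+1 :> nat by apply: contraNneq ne => E; apply/eqP/val_inj.
  by rewrite mul0r.
rewrite addr0; congr (_ - _).
rewrite (bigD1 (Ordinal li')) //= eqxx mul1r big1 => [|j ne]; last first.
  have /negPf -> : j != i :> nat by apply: contraNneq ne => E; apply/eqP/val_inj.
  by rewrite mul0r.
by rewrite addr0.
Qed.

(** The discrete Leibniz rule for an affine factor; it drives both inductions on
    the degree below, for powers and for truncated powers. *)
Lemma fdiff_leibniz (R : comPzRingType) N (s : R) (F : nat -> R) i :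
  iter N (@fdiff R) (fun i => (i%:R - s) * F i) i =
  ((i + N)%N%:R - s) * iter N (@fdiff R) F i + N%:R * iter N.-1 (@fdiff R) F i.
Proof.
elim: N i => [|N IH] i; first by rewrite /= addn0; ring.
rewrite iterS /fdiff !IH.
case: N {IH} => [|N] /=; first by rewrite /fdiff !addn0 addn1 -natr1; ring.
rewrite /fdiff !addnS !addSn -!natr1 natrD; ring.
Qed.

Lemma fdiff_monomial (R : comPzRingType) N j i : (j < N)%N ->
  iter N (@fdiff R) (fun i => i.+1%:R ^+ j) i = 0.
Proof.
elim: j N i => [|j IH] [|N] i //= jN.
  elim: N i {jN} => [|N IH] i; first by rewrite /= /fdiff !expr0 subrr.
  by rewrite iterS {1}/fdiff !IH subrr.
rewrite -iterS (@eq_iter_fdiff _ _ _ (fun i => (i%:R - -1) * (i.+1%:R ^+ j))); last first.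
  by move=> m; rewrite opprK natr1 exprS.
by rewrite fdiff_leibniz succnK !IH ?mulr0 ?addr0 //; lia.
Qed.

(** Each difference turns the running sum [sigma k.+1] back into [sigma k]; after
    [k] of them a unit step is left, and its difference is a unit impulse. *)
Lemma fdiff_sigma (R : pzRingType) k j i : (k < j)%N ->
  iter k.+1 (@fdiff R)
    (fun i => if (i < j)%N then 0 else (sigma k (i - j + 1))%:R) i
  = (i + k.+1 == j)%N%:R.
Proof.
elim: k j i => [|k IH] j i kj.
  rewrite /= /fdiff /= addn1; case: (ltnP i.+1 j) => a; case: (ltnP i j) => b.
  - by rewrite subrr (_ : (_ == _) = false) //; lia.
  - by lia.
  - by rewrite subr0 (_ : (_ == _) = true) //; lia.
  - by rewrite subrr (_ : (_ == _) = false) //; lia.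
have -> : (i + k.+2 == j)%N = (i + k.+1 == j.-1)%N by lia.
rewrite -IH; last by lia.
rewrite iterSr; apply: eq_iter_fdiff => m; rewrite /fdiff.
case: (ltnP m.+1 j) => mj.
  by rewrite ltnW // subr0 ifT //; lia.
rewrite [in RHS]ifF; last by lia.
case: (ltnP m j) => mj'.
  have -> : (m.+1 - j + 1 = 1)%N by lia.
  have -> : (m - j.-1 + 1 = 1)%N by lia.
  by rewrite subr0 /= big_nat1.
have -> : (m.+1 - j + 1 = (m - j + 1).+1)%N by lia.
have -> : (m - j.-1 + 1 = (m - j + 1).+1)%N by lia.
by rewrite /= big_nat_recr //= natrD addrAC subrr add0r.
Qed.

(** [eulerian k m] is the number of permutations of [k] letters with [m - 1]
    descents.  The index is shifted by one so that
    [sum_m eulerian k m x^m = (1 - x)^(k+1) sum_m m^k x^m] holds for [k > 0]; the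
    value at [k = 0] is the one that makes the recursion start. *)
Fixpoint eulerian (k m : nat) : nat :=
  if k is k'.+1 then
    (m * eulerian k' m + (k'.+2 - m) * (if m is m'.+1 then eulerian k' m' else 0))%N
  else (m == 1%N).

Lemma eulerian_small k m : (k.+1 < m)%N -> eulerian k m = 0%N.
Proof.
elim: k m => [|k IH] [|m] //= km; first by lia.
by rewrite IH ?IH //; lia.
Qed.

Lemma eulerian_gt0 k : (0 < k)%N -> (0 < eulerian k k)%N.
Proof.
case: k => // k _; elim: k => [|k IH] //.
have -> : eulerian k.+2 k.+2 =
  (k.+2 * eulerian k.+1 k.+2 + (k.+3 - k.+2) * eulerian k.+1 k.+1)%N by [].
by rewrite subSnn; lia.
Qed.

Lemma eulerian0 k : eulerian k 0 = 0%N.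
Proof. by case: k => [|k] //=; rewrite muln0. Qed.

Lemma sum_eulerian k : (\sum_(0 <= m < k.+2) eulerian k m)%N = k`!.
Proof.
elim: k => [|k IH]; first by rewrite !big_nat_recr //= big_geq.
rewrite factS -IH big_distrr /= big_split /=.
rewrite big_nat_recr //= eulerian_small // muln0 addn0.
rewrite [X in (_ + X)%N]big_nat_recl //= muln0 add0n.
rewrite -big_split /=; apply: eq_big_nat => m /andP[_ mk].
by rewrite subSS -mulnDl; congr (_ * _)%N; lia.
Qed.

(** Worpitzky's identity in difference form.  Multiplying the truncated power by
    [i - s] raises its degree, and [fdiff_leibniz] then reproduces the Eulerian
    recursion. *)
Lemma fdiff_truncpow (R : comPzRingType) k s i :
  iter k.+1 (@fdiff R)
    (fun i => if (s < i)%N then (i - s)%:R ^+ k else 0) i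
  = (eulerian k (i + k.+1 - s)%N)%:R.
Proof.
elim: k i => [|k IH] i.
  rewrite /= /fdiff /= !expr0 addn1; case: (ltnP s i.+1) => a; case: (ltnP s i) => b.
  - by rewrite subrr (_ : (_ == _) = false) //; lia.
  - by rewrite subr0 (_ : (_ == _) = true) //; lia.
  - by lia.
  - by rewrite subrr (_ : (_ == _) = false) //; lia.
rewrite (@eq_iter_fdiff _ _ _ (fun i => (i%:R - s%:R) *
   (if (s < i)%N then (i - s)%:R ^+ k else 0))); last first.
  by move=> m; case: ltnP => ms; rewrite ?mulr0 // exprS natrB // ltnW.
rewrite fdiff_leibniz /= -[fdiff (iter k _ _)]/(iter k.+1 _ _).
rewrite {1}/fdiff !IH addSn.
have -> : (i + k.+2 = (i + k.+1).+1)%N by lia.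
set M := (i + k.+1)%N.
case: (leqP M.+1 s) => Ms.
  have -> : (M.+1 - s = 0)%N by lia.
  have -> : (M - s = 0)%N by lia.
  by rewrite muln0 eulerian0; ring.
have E : (M.+1 - s = (M - s).+1)%N by lia.
rewrite -natrB ?(ltnW Ms) // E; set m := (M - s)%N.
have [mk|mk] := leqP m k.+1.
  rewrite natrD !natrM natrB //; ring.
by rewrite (eulerian_small mk) (eulerian_small (leqW mk)) !muln0 !mulr0 ?addr0 ?subr0 ?mulr0.
Qed.

(** * First-order conditions for penalized least squares *)

Definition dot (R : pzRingType) n (u v : 'cV[R]_n) : R := \sum_i u i 0 * v i 0.

Section Dot.
Variables (R : comPzRingType) (n : nat).
Implicit Types u v w : 'cV[R]_n.

Lemma dotC u v : dot u v = dot v u.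
Proof. by apply: eq_bigr => i _; rewrite mulrC. Qed.

Lemma dotDl u v w : dot (u + v) w = dot u w + dot v w.
Proof. by rewrite -big_split; apply: eq_bigr => i _; rewrite mxE mulrDl. Qed.

Lemma dotZl a u w : dot (a *: u) w = a * dot u w.
Proof. by rewrite big_distrr; apply: eq_bigr => i _; rewrite mxE /= mulrA. Qed.

Lemma dotNl u w : dot (- u) w = - dot u w.
Proof. by rewrite -scaleN1r dotZl mulN1r. Qed.

Lemma dotBl u v w : dot (u - v) w = dot u w - dot v w.
Proof. by rewrite dotDl dotNl. Qed.

Lemma dotDr u v w : dot w (u + v) = dot w u + dot w v.
Proof. by rewrite dotC dotDl !(dotC w). Qed.

Lemma dotZr a u w : dot w (a *: u) = a * dot w u.
Proof. by rewrite dotC dotZl (dotC w). Qed.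

Lemma dotNr u w : dot w (- u) = - dot w u.
Proof. by rewrite dotC dotNl (dotC w). Qed.

Lemma dotBr u v w : dot w (u - v) = dot w u - dot w v.
Proof. by rewrite dotDr dotNr. Qed.

Lemma dotE u v : dot u v = (u^T *m v) 0 0.
Proof. by rewrite mxE; apply: eq_bigr => i _; rewrite mxE. Qed.

End Dot.

Lemma dot_eq0 (R : realDomainType) n (u : 'cV[R]_n) : dot u u <= 0 -> u = 0.
Proof.
have dot_ge0 : forall i, true -> 0 <= u i 0 * u i 0.
  by move=> i _; rewrite -expr2 sqr_ge0.
move=> u0; have /eqP : dot u u = 0 by apply/le_anti; rewrite u0 sumr_ge0.
rewrite psumr_eq0 // => /allP uu0; apply/matrixP => i j; rewrite ord1 mxE.
by have /eqP := uu0 i (mem_index_enum _); rewrite -expr2 => /eqP; rewrite sqrf_eq0 => /eqP.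
Qed.

Definition lsq_obj (R : realFieldType) n p (X : 'M[R]_(n, p)) (y : 'cV[R]_n)
    (P : 'cV[R]_p -> R) (theta : 'cV[R]_p) : R :=
  2^-1 * dot (y - X *m theta) (y - X *m theta) + P theta.

(** If [b < a], then [t = (a - b) / (2 c + (a - b))] violates the hypothesis. *)
Lemma ler_of_lerD_scale (R : realFieldType) (a b c : R) :
  (forall t, 0 < t <= 1 -> a <= b + t * c) -> a <= b.
Proof.
move=> h; rewrite leNgt; apply/negP => ba.
have c0 : 0 < c by have := h 1; rewrite ltr01 lexx => /(_ isT); lra.
pose t := (a - b) / (2 * c + (a - b)).
have tp : 0 < t by rewrite divr_gt0 //; lra.
have t1 : t <= 1 by rewrite ler_pdivrMr; lra.
have := h t; rewrite tp t1 => /(_ isT).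
have tE : t * (2 * c + (a - b)) = a - b by rewrite divfK //; lra.
nra.
Qed.

(** Stationarity in the direction [w], for a penalty that grows at most linearly
    along [w]: the squared error contributes [- t <X w, r> + O(t^2)], and the
    quadratic term is negligible as [t] tends to 0. *)
Lemma lsq_first_order (R : realFieldType) n p (X : 'M[R]_(n, p)) y P theta w B :
  (forall s, lsq_obj X y P theta <= lsq_obj X y P s) ->
  (forall t, 0 < t <= 1 -> P (theta + t *: w) <= P theta + t * B) ->
  dot (X *m w) (y - X *m theta) <= B.
Proof.
move=> min_theta PB.
apply: (@ler_of_lerD_scale _ _ _ (2^-1 * dot (X *m w) (X *m w))) => t /andP[t0 t1].
have := min_theta (theta + t *: w); have := PB t; rewrite t0 t1 => /(_ isT).
rewrite /lsq_obj mulmxDr -scalemxAr opprD addrA.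
move: (y - X *m theta) (X *m w) => r v.
rewrite (dotBl _ _ (r - _)) !dotBr !dotZl !dotZr (dotC r v) => h1 h2.
rewrite -(ler_pM2l t0). nra.
Qed.

(** The stationarity inequalities of the two minimizers, each in the direction of
    the other, add up to [|X (theta - alpha)|^2 <= 0]. *)
Lemma lsq_fit_unique (R : realFieldType) n p (X : 'M[R]_(n, p)) y P theta alpha :
  (forall u v t, 0 < t <= 1 -> P (u + t *: (v - u)) <= P u + t * (P v - P u)) ->
  (forall s, lsq_obj X y P theta <= lsq_obj X y P s) ->
  (forall s, lsq_obj X y P alpha <= lsq_obj X y P s) ->
  X *m theta = X *m alpha.
Proof.
move=> convP min_theta min_alpha.
have := lsq_first_order min_theta (convP theta alpha).
have := lsq_first_order min_alpha (convP alpha theta).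
rewrite !mulmxBr => h1 h2; apply/eqP; rewrite -subr_eq0; apply/eqP/dot_eq0.
move: h1 h2; rewrite !(dotBl, dotBr) !(dotC (X *m theta) (X *m alpha)); lra.
Qed.

Lemma lasso_objE (R : realType) k n (X : 'M[R]_n) y lambda theta :
  lasso_obj k X y lambda theta =
  lsq_obj X y (fun t => lambda * \sum_(j < n | (k < j)%N) `|t j 0|) theta.
Proof.
rewrite /lasso_obj /lsq_obj /dot; congr (_ * _ + _).
by apply: eq_bigr => i _; rewrite !mxE expr2.
Qed.

Lemma tf_objE (R : realType) k n (y : 'cV[R]_n) lambda beta :
  tf_obj k y lambda beta =
  lsq_obj 1%:M y (fun b => n%:R ^+ k / k`!%:R * lambda *
                           \sum_i `|(diffop R n k.+1 *m b) i 0|) beta.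
Proof.
rewrite /tf_obj /lsq_obj /dot mul1mx; congr (_ * _ + _).
by apply: eq_bigr => i _; rewrite !mxE expr2.
Qed.

Lemma lasso_fit_unique (R : realType) k n (X : 'M[R]_n) y lambda theta alpha :
  0 <= lambda ->
  argmin setT (lasso_obj k X y lambda) theta ->
  argmin setT (lasso_obj k X y lambda) alpha ->
  X *m theta = X *m alpha.
Proof.
move=> l0 [_ mt] [_ ma].
apply: (@lsq_fit_unique _ _ _ _ y (fun t => lambda * \sum_(j < n | (k < j)%N) `|t j 0|)).
- move=> u v t /andP[t0 t1].
  rewrite -mulrBr mulrCA -mulrDr ler_wpM2l // -sumrB mulr_sumr -big_split /=.
  apply: ler_sum => j _; rewrite !mxE.
  have -> : u j 0 + t * (v j 0 - u j 0) = (1 - t) * u j 0 + t * v j 0 by ring.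
  apply: le_trans (ler_normD _ _) _; rewrite !normrM (ger0_norm (ltW t0)) ger0_norm; lra.
- by move=> s; rewrite -!lasso_objE; exact: mt.
- by move=> s; rewrite -!lasso_objE; exact: ma.
Qed.

(** Shrinking the coordinate [theta l] towards 0 lowers the penalty at the rate
    [lambda |theta l|], so the squared error must resist at that rate. *)
Lemma lasso_active (R : realType) k n (X : 'M[R]_n) y lambda theta (l : 'I_n) :
  0 <= lambda ->
  (k < l)%N -> argmin setT (lasso_obj k X y lambda) theta -> theta l 0 != 0 ->
  lambda <= `|dot (col l X) (y - X *m theta)|.
Proof.
move=> l0 kl [_ mt] tl0.
have : dot (X *m (- theta l 0 *: delta_mx l 0)) (y - X *m theta) <= - (lambda * `|theta l 0|).
  apply: (@lsq_first_order _ _ _ X y (fun t => lambda * \sum_(j < n | (k < j)%N) `|t j 0|)).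
    by move=> s; rewrite -!lasso_objE; exact: mt.
  move=> t /andP[t0 t1].
  rewrite (bigD1 l) //= [in leRHS](bigD1 l) //= !mxE !eqxx mulr1.
  under eq_bigr => j /andP[_ /negPf jl] do rewrite !mxE jl mulr0 mulr0 addr0.
  have -> : theta l 0 + t * - theta l 0 = (1 - t) * theta l 0 by ring.
  rewrite normrM (@ger0_norm _ (1 - t)); last lra.
  by rewrite le_eqVlt; apply/orP; left; apply/eqP; ring.
rewrite -scalemxAr dotZl -colE.
have : 0 < `|theta l 0| by rewrite normr_gt0.
set d := dot _ _ => tp h.
rewrite -(ler_pM2r tp) -normrM; apply: le_trans (ler_norm _); nra.
Qed.

(** By duality the residual is [lambda c] times the transposed difference operator
    applied to a vector with entries between -1 and 1; the bound says this
    without introducing that vector. *)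
Lemma tf_residual (R : realType) k n (y : 'cV[R]_n) lambda beta v :
  0 <= lambda -> tf_estimate k y lambda beta ->
  `|dot v (y - beta)| <=
    n%:R ^+ k / k`!%:R * lambda * \sum_i `|(diffop R n k.+1 *m v) i 0|.
Proof.
move=> l0 [_ mb].
have c0 : 0 <= n%:R ^+ k / k`!%:R * lambda by rewrite !mulr_ge0 ?exprn_ge0 ?invr_ge0.
have key : forall v, dot v (y - beta) <=
    n%:R ^+ k / k`!%:R * lambda * \sum_i `|(diffop R n k.+1 *m v) i 0|.
  move=> {}v; rewrite -[X in dot X]mul1mx -[X in y - X]mul1mx.
  apply: (lsq_first_order (P := fun b => n%:R ^+ k / k`!%:R * lambda *
                           \sum_i `|(diffop R n k.+1 *m b) i 0|)).
    by move=> s; rewrite -!tf_objE; exact: mb.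
  move=> t /andP[t0 _]; rewrite mulrCA -mulrDr ler_wpM2l // mulr_sumr -big_split /=.
  apply: ler_sum => i _; rewrite mulmxDr -scalemxAr !mxE.
  by apply: le_trans (ler_normD _ _) _; rewrite normrM (gtr0_norm t0).
rewrite ler_norml key andbT lerNl -dotNl; apply: le_trans (key _) _.
rewrite ler_wpM2l //; apply: ler_sum => i _.
by rewrite mulmxN mxE normrN.
Qed.

(** * The falling factorial basis and trend filtering *)

Lemma sum_iter_predn (R : nmodType) m n (F : nat -> R) :
  \sum_(i < iter m predn n) F i = \sum_(0 <= i < n - m) F i.
Proof. by rewrite -(big_mkord xpredT F) iter_predn. Qed.

Lemma sum_diff_rows (R : nmodType) m n (F : nat -> R) :
  \sum_(i < iter m predn n) F (i + m)%N = \sum_(j < n | (m <= j)%N) F j.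
Proof.
rewrite (sum_iter_predn _ _ (fun i => F (i + m)%N)).
transitivity (\sum_(m <= j < n) F j); last exact: (big_geq_mkord _ _ xpredT F).
by rewrite -{3}[m]add0n big_addn.
Qed.

Lemma diffop_tf_col (R : realType) k n (j : 'I_n) i :
  (diffop R n k.+1 *m col j (tf_basis R k n)) i 0 =
  k`!%:R / n%:R ^+ k * (i + k.+1 == j)%N%:R.
Proof.
pose F := fun m => tf_entry R k n m.+1 j.+1.
rewrite (@diffop_fdiff _ _ _ F); last by move=> m; rewrite !mxE.
case: (leqP j k) => jk.
  have -> : (i + k.+1 == j)%N = false by lia.
  rewrite mulr0 (@eq_iter_fdiff _ _ _ (fun m => (n%:R ^+ j)^-1 * m.+1%:R ^+ j)).
    by rewrite iter_fdiff_scale fdiff_monomial ?mulr0.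
  by move=> m; rewrite /F /tf_entry ltnS jk subSS subn0 mulrC.
rewrite -(fdiff_sigma _ i jk) -iter_fdiff_scale; apply: eq_iter_fdiff => m.
rewrite /F /tf_entry ltnS leqNgt jk /= subSS subn0.
by case: ltnP => // mj; rewrite ?mulr0 // subSS -mulrA mulrC.
Qed.

Lemma mulmx_col_sum (R : comPzRingType) m n (A : 'M[R]_(m, n)) (v : 'cV[R]_n) :
  A *m v = \sum_j v j 0 *: col j A.
Proof.
apply/matrixP => i j; rewrite ord1 mxE summxE; apply: eq_bigr => l _.
by rewrite !mxE mulrC.
Qed.

(** The entries of [v] as a sequence, extended by 0: sums over shifted ranges of
    indices can then be reindexed without building ordinals. *)
Definition ext0 (R : pzRingType) n (v : 'cV[R]_n) (m : nat) : R :=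
  \sum_(j < n) (m == j)%N%:R * v j 0.

Lemma ext0E (R : pzRingType) n (v : 'cV[R]_n) (j : 'I_n) : ext0 v j = v j 0.
Proof.
rewrite /ext0 (bigD1 j) //= eqxx mul1r big1 ?addr0 // => l lj.
by rewrite [(_ == _)%N](negPf _) ?mul0r // eq_sym; exact: lj.
Qed.

Lemma diffop_tf_mul (R : realType) k n (alpha : 'cV[R]_n) i :
  (diffop R n k.+1 *m (tf_basis R k n *m alpha)) i 0 =
  k`!%:R / n%:R ^+ k * ext0 alpha (i + k.+1).
Proof.
rewrite mulmxA mulmx_col_sum summxE mulr_sumr; apply: eq_bigr => j _.
by rewrite mxE colE -mulmxA -colE diffop_tf_col; ring.
Qed.

(** The factor [n^k / k!] in the trend filtering penalty is exactly the inverse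
    of the nonzero entries of the differenced basis. *)
Lemma tf_obj_lasso (R : realType) k n (y : 'cV[R]_n) lambda alpha :
  (0 < n)%N ->
  tf_obj k y lambda (tf_basis R k n *m alpha) =
  lasso_obj k (tf_basis R k n) y lambda alpha.
Proof.
move=> n0; rewrite /tf_obj /lasso_obj; congr (_ + _).
have nk0 : n%:R ^+ k != 0 :> R by rewrite expf_neq0 // pnatr_eq0; lia.
have k0 : k`!%:R != 0 :> R by rewrite pnatr_eq0 -lt0n fact_gt0.
under eq_bigr => i _ do rewrite diffop_tf_mul normrM.
rewrite -mulr_sumr (sum_diff_rows k.+1 n (fun m => `|ext0 alpha m|)).
under eq_bigr => j _ do rewrite ext0E.
rewrite ger0_norm ?divr_ge0 ?exprn_ge0 // !mulrA; congr (_ * _).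
by field; rewrite nk0 k0.
Qed.

Lemma tf_basis_inj (R : realType) k n (alpha : 'cV[R]_n) :
  (k < n)%N -> tf_basis R k n *m alpha = 0 -> alpha = 0.
Proof.
move=> kn Ha.
have n0 : (0 < n)%N by lia.
have nR0 m : n%:R ^+ m != 0 :> R by rewrite expf_neq0 // pnatr_eq0; lia.
have k0 : k`!%:R != 0 :> R by rewrite pnatr_eq0 -lt0n fact_gt0.
have tail (j : 'I_n) : (k < j)%N -> alpha j 0 = 0.
  move=> kj.
  have lt : (j - k.+1 < iter k.+1 predn n)%N by rewrite iter_predn; have := ltn_ord j; lia.
  have := @diffop_tf_mul _ k _ alpha (Ordinal lt); rewrite Ha mulmx0 mxE /= subnK // ext0E.
  move/esym/eqP; rewrite !mulf_eq0 invr_eq0 (negPf (nR0 k)) (negPf k0) /=.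
  by move/eqP.
(* The fitted values are those of [p] at the points [1, ..., n], too many
   roots for its degree. *)
pose p := \poly_(j < k.+1) (ext0 alpha j / n%:R ^+ j).
suff p0 : p = 0.
  apply/matrixP => j l; rewrite ord1 [RHS]mxE; case: (leqP j k) => jk; last exact: tail.
  have := coef0 R j; rewrite -p0 coef_poly ltnS jk ext0E => /eqP.
  by rewrite mulf_eq0 invr_eq0 (negPf (nR0 j)) orbF => /eqP.
apply: (@roots_geq_poly_eq0 _ p [seq i.+1%:R | i <- iota 0 n]).
- apply/allP => x /mapP[i]; rewrite mem_iota /= add0n => ilt -> {x}.
  have /matrixP /(_ (Ordinal ilt) 0) := Ha; rewrite mxE [RHS]mxE => E.
  rewrite /root; apply/eqP; rewrite -{}[RHS]E horner_poly.
  rewrite [in RHS](bigID (fun j : 'I_n => (j <= k)%N)) /= [X in _ + X]big1 ?addr0; last first.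
    by move=> j; rewrite -ltnNge => kj; rewrite tail ?mulr0.
  rewrite (big_ord_widen n (fun j => ext0 alpha j / n%:R ^+ j * i.+1%:R ^+ j)) //.
  apply: eq_big => j; first by rewrite ltnS.
  rewrite ltnS => jk; rewrite ext0E !mxE /tf_entry ltnS jk subSS subn0; ring.
- by rewrite map_inj_uniq ?iota_uniq // => a b /eqP; rewrite eqr_nat => /eqP [].
- by rewrite size_map size_iota; apply: leq_trans (size_poly _ _) _.
Qed.

Lemma unitmx_inj (F : fieldType) n (A : 'M[F]_n) :
  (forall v : 'cV_n, A *m v = 0 -> v = 0) -> A \in unitmx.
Proof.
move=> inj; rewrite -unitmx_tr -row_free_unit -kermx_eq0.
apply/rowV0P => v /sub_kermxP vA; apply: trmx_inj; rewrite trmx0; apply: inj.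
by apply: trmx_inj; rewrite trmx_mul trmxK trmx0.
Qed.

Lemma tf_basis_unit (R : realType) k n : (k < n)%N -> tf_basis R k n \in unitmx.
Proof. by move=> kn; apply: unitmx_inj => v; exact: tf_basis_inj. Qed.

Lemma tf_estimate_lasso (R : realType) k n (y : 'cV[R]_n) lambda beta :
  (k < n)%N -> tf_estimate k y lambda beta ->
  exists2 alpha, beta = tf_basis R k n *m alpha &
    argmin setT (lasso_obj k (tf_basis R k n) y lambda) alpha.
Proof.
move=> kn [_ mb]; exists (invmx (tf_basis R k n) *m beta).
  by rewrite mulKVmx // tf_basis_unit.
split=> // s _; rewrite -!tf_obj_lasso ?mulKVmx ?tf_basis_unit //; first exact: mb.
- lia.
- lia.
Qed.

Lemma lasso_tf_estimate (R : realType) k n (y : 'cV[R]_n) lambda alpha :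
  (k < n)%N -> argmin setT (lasso_obj k (tf_basis R k n) y lambda) alpha ->
  tf_estimate k y lambda (tf_basis R k n *m alpha).
Proof.
move=> kn [_ ma]; split=> // s _.
rewrite -[s](mulKVmx (tf_basis_unit R kn)) !tf_obj_lasso; first exact: ma.
- lia.
- lia.
Qed.

(** * The truncated power basis *)

(** One formula for both parities of [k]: the knot of column [j] is
    [x_(j - uphalf k)]. *)
Lemma lars_entry_trunc (R : realType) k n i j : (0 < k)%N -> (k.+1 < j)%N ->
  lars_entry R k n i j =
  (if (j - uphalf k < i)%N then (i - (j - uphalf k))%:R ^+ k else 0) / n%:R ^+ k.
Proof.
move=> k0 kj; have qk : (uphalf k <= j)%N by lia.
rewrite /lars_entry [k == 0%N]eqn0Ngt k0 (leqNgt j) kj /=.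
have key q : q = uphalf k -> (if (i <= j - q)%N then 0
   else (i%:R - j%:R + q%:R) ^+ k / n%:R ^+ k) =
  (if (j - uphalf k < i)%N then (i - (j - uphalf k))%:R ^+ k else 0) / n%:R ^+ k :> R.
  move=> ->; case: leqP => ij; first by rewrite mul0r.
  by rewrite !natrB ?(ltnW ij) // opprB addrA (addrAC i%:R).
case: ifP => ok; apply: key; lia.
Qed.

Lemma lars_tf_basis_eq (R : realType) k n : k = 0%N \/ k = 1%N ->
  lars_basis R k n = tf_basis R k n.
Proof.
move=> k01; apply/matrixP => i j; rewrite !mxE /tf_entry.
case: (leqP j.+1 k.+1) => jk; case: k01 => k1; subst k.
- by rewrite /lars_entry /=; have -> : nat_of_ord j = 0%N; [lia | rewrite ltnS ltn0 expr0 divr1].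
- by rewrite /lars_entry /= jk.
- rewrite /lars_entry /= subSS subn0 !ltnS fact0 expr0 invr1 !mulr1.
  by case: ltnP.
- rewrite lars_entry_trunc // /= subSS subn0 ltnS expr1 (_ : 1`! = 1%N) // mulr1.
  case: leqP => ji; last by rewrite mul0r.
  congr (_%:R / _).
  by rewrite sum_nat_const_nat; lia.
Qed.

Lemma lars_last_entry (R : realType) k n (i : nat) : (0 < k)%N -> (k.+1 < n)%N ->
  lars_entry R k n i.+1 n =
   (if (n - (uphalf k).+1 < i)%N then (i - (n - (uphalf k).+1))%:R ^+ k else 0) / n%:R ^+ k.
Proof.
move=> k0 kn; rewrite lars_entry_trunc //.
have -> : (n - uphalf k = (n - (uphalf k).+1).+1)%N by lia.
by rewrite ltnS subSS.
Qed.

(** The entries of the differenced column are [eulerian k m / n^k] for [m] up to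
    [uphalf k].  All Eulerian numbers of order [k] sum to [k!], and the one of
    index [k > uphalf k] is positive and missing. *)
Lemma lars_last_diff_lt1 (R : realType) k n (l : 'I_n) : (2 <= k)%N -> (k.+1 < n)%N ->
  l = n.-1 :> nat ->
  n%:R ^+ k / k`!%:R *
    \sum_i `|(diffop R n k.+1 *m col l (lars_basis R k n)) i 0| < 1.
Proof.
move=> k2 kn ln.
set q := uphalf k; set s := (n - q.+1)%N.
have qk : (q < k)%N by rewrite /q; lia.
have nk0 : 0 < n%:R ^+ k :> R by rewrite exprn_gt0 // ltr0n; lia.
have kf0 : 0 < k`!%:R :> R by rewrite ltr0n fact_gt0.
pose F := fun m => lars_entry R k n m.+1 l.+1.
have FE i : (diffop R n k.+1 *m col l (lars_basis R k n)) i 0 =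
    (n%:R ^+ k)^-1 * (eulerian k (i + k.+1 - s)%N)%:R.
  rewrite (@diffop_fdiff _ _ _ F); last by move=> m; rewrite !mxE.
  rewrite -fdiff_truncpow -iter_fdiff_scale; apply: eq_iter_fdiff => m.
  rewrite /F ln prednK; last lia.
  by rewrite lars_last_entry; [rewrite mulrC | lia | exact: kn].
under eq_bigr => i _ do rewrite FE normrM gtr0_norm ?invr_gt0 // normr_nat.
rewrite -mulr_sumr mulrA -(mulrA _ _^-1) (mulrC k`!%:R^-1) mulrA divff ?mul1r ?gt_eqF //.
rewrite mulrC ltr_pdivrMr // mul1r -natr_sum ltr_nat.
rewrite (sum_diff_rows k.+1 n (fun j => eulerian k (j - s)%N)) -sum_eulerian.
apply: (@leq_ltn_trans (\sum_(0 <= m < q.+1) eulerian k m)%N).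
  have sn : (s <= n)%N by rewrite /s; lia.
  apply: (@leq_trans (\sum_(0 <= j < n) eulerian k (j - s))%N).
    (* The rows [j <= k] are not differences of [g]; adding them only
       increases the sum. *)
    rewrite big_mkord [leqRHS](bigID (fun j : 'I_n => (k < j)%N)) /=; exact: leq_addr.
  rewrite (@big_cat_nat _ _ _ s) //= big_nat_cond big1 ?add0n; last first.
    move=> j; rewrite andbT => /andP[_ js].
    by have -> : (j - s = 0)%N by [lia]; rewrite eulerian0.
  rewrite -{1}[s]add0n big_addn; have -> : (n - s = q.+1)%N by rewrite /s; lia.
  by apply: leq_sum => j _; rewrite addnK.
rewrite (@big_cat_nat _ _ _ q.+1 0 k.+2) //=; last lia.
rewrite -[X in (X < _)%N]addn0 ltn_add2l.
rewrite (@big_cat_nat _ _ _ k q.+1 k.+2) //=; last lia.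
rewrite big_nat_recr // big_nat1.
have : (0 < eulerian k k)%N by rewrite eulerian_gt0; lia.
rewrite /=; lia.
Qed.

(** * The two estimates differ when k >= 2 *)

(** The vector [a] is the row [l] of the inverse of [G]; if [G] is singular it is a
    nonzero vector orthogonal to the range, and the implication is vacuous. *)
Lemma lars_functional (R : realType) n (G : 'M[R]_n) (l : 'I_n) :
  exists2 a : 'cV[R]_n, a != 0 &
    forall theta, dot a (G *m theta) != 0 -> theta l 0 != 0.
Proof.
case: (boolP (G \in unitmx)) => [Gu|].
  exists ((row l (invmx G))^T).
    apply: contraTneq isT => /(congr1 (fun u => (u^T *m G) 0 l)).
    rewrite trmxK -row_mul mulVmx // trmx0 mul0mx !mxE eqxx => /eqP.
    by rewrite oner_eq0.
  by move=> theta; rewrite dotE trmxK mulmxA -row_mul mulVmx // -row_mul mul1mx mxE.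
rewrite -row_free_unit -kermx_eq0 => /rowV0Pn[v /sub_kermxP vG v0].
exists v^T; first by rewrite -(inj_eq trmx_inj) trmxK trmx0.
by move=> theta; rewrite dotE trmxK mulmxA vG mul0mx mxE eqxx.
Qed.

(** The tuning parameter [lambda'] of the lasso may exceed [lambda]: it is
    [lambda] for the displayed lasso problem, and [lambda k!] for the spline
    estimate. *)
Lemma fits_differ (R : realType) k n : (2 <= k)%N -> (k + 2 <= n)%N ->
  exists2 a : 'cV[R]_n, a != 0 & forall y, dot a y != 0 ->
    exists2 lambda0 : R, 0 < lambda0 & forall lambda, 0 < lambda < lambda0 ->
    forall lambda' beta theta, lambda <= lambda' -> tf_estimate k y lambda beta ->
      argmin setT (lasso_obj k (lars_basis R k n) y lambda') theta ->
      lars_basis R k n *m theta <> beta.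
Proof.
move=> k2 kn.
have ln : (n.-1 < n)%N by lia.
pose l := Ordinal ln.
have [a a0 aG] := lars_functional (lars_basis R k n) l.
exists a => // y ay.
(* By [tf_residual], [|<a, y - beta>| <= lambda C]. *)
pose C : R := n%:R ^+ k / k`!%:R * \sum_i `|(diffop R n k.+1 *m a) i 0|.
have C0 : 0 <= C by rewrite !mulr_ge0 ?exprn_ge0 ?invr_ge0 ?sumr_ge0.
have ay0 : 0 < `|dot a y| by rewrite normr_gt0.
exists (`|dot a y| / (C + 1)); first by rewrite divr_gt0 //; lra.
move=> lambda /andP[l0 ll0] lambda' beta theta ll' tfb mt E.
have aG0 : dot a beta != 0.
  apply: contraTneq ll0 => ab0; rewrite -leNgt ler_pdivrMr; last lra.
  have := tf_residual a (ltW l0) tfb; rewrite dotBr ab0 subr0 => /le_trans; apply.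
  by rewrite mulrAC -/C mulrC ler_wpM2l ?(ltW l0) // lerDl.
have tl0 : theta l 0 != 0 by apply: aG; rewrite E.
have := @lars_last_diff_lt1 R k n l k2 _ erefl; have kn' : (k.+1 < n)%N by lia.
move=> /(_ kn'); apply/negP; rewrite -leNgt.
have kl : (k < l)%N by rewrite /=; lia.
have := lasso_active (le_trans (ltW l0) ll') kl mt tl0; rewrite E => h1.
have := tf_residual (col l (lars_basis R k n)) (ltW l0) tfb => h2.
have := le_trans ll' (le_trans h1 h2).
by rewrite mulrAC -[leLHS]mul1r ler_pM2r.
Qed.

(** If the objectives agreed everywhere, polarization would make the difference
    [d] of the last columns of [G] and [H] orthogonal to the shared polynomial
    columns.  Testing [d] against the columns 1 and [x] gives
    [sum_i g_i (n - i) = 0] for the nonnegative last column [g] of [G], so [g] is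
    supported on the last row, which forces [k = 2]; but then the last entries are
    [1 / n^2] and [2 / n^2]. *)
Lemma lasso_objs_differ (R : realType) k n (y : 'cV[R]_n) lambda :
  (2 <= k)%N -> (k + 2 <= n)%N ->
  exists theta, lasso_obj k (lars_basis R k n) y lambda theta <>
                lasso_obj k (tf_basis R k n) y lambda theta.
Proof.
move=> k2 kn; apply: contrapT => /forallNP no.
have {}no theta : lasso_obj k (lars_basis R k n) y lambda theta =
    lasso_obj k (tf_basis R k n) y lambda theta by apply: contrapT; exact: no.
have ln : (n.-1 < n)%N by lia.
pose l := Ordinal ln.
pose d := col l (lars_basis R k n) - col l (tf_basis R k n).
(* The objectives at [e_l + e_j] and [e_l - e_j] differ by a term bilinear in
   the two columns; the penalties cancel. *)
have polar (j : 'I_n) : (j <= k)%N -> dot d (col j (tf_basis R k n)) = 0.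
  move=> jk.
  have cj : col j (lars_basis R k n) = col j (tf_basis R k n).
    apply/matrixP => i m; rewrite !mxE /tf_entry /lars_entry !ltnS jk.
    case: eqP => // k0; lia.
  have := no (delta_mx l 0 + delta_mx j 0); have := no (delta_mx l 0 - delta_mx j 0).
  rewrite !lasso_objE /lsq_obj => /addIr /(mulfI _) h1 /addIr /(mulfI _) h2.
  have two0 : 2^-1 != 0 :> R by rewrite invr_eq0 pnatr_eq0.
  move: (h1 two0) (h2 two0) => {h1 h2}.
  rewrite !mulmxDr !mulmxN -!colE cj /d.
  move: (col l _) (col l _) (col j _) => g h v.
  rewrite !(dotDl, dotDr, dotNl, dotNr) !(dotC v) !(dotC _ y).
  lra.
pose g i : R := (if (n - (uphalf k).+1 < i)%N then (i - (n - (uphalf k).+1))%:R ^+ k else 0).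
pose dd i : R := (g i - (i == n.-1)%N%:R * k`!%:R).
have nk0 : n%:R ^+ k != 0 :> R by rewrite expf_neq0 // pnatr_eq0; lia.
have nR0 : n%:R != 0 :> R by rewrite pnatr_eq0; lia.
have dE i : d i 0 = dd i / n%:R ^+ k.
  rewrite !mxE /= prednK ?lars_last_entry; [|lia..].
  rewrite /dd mulrBl; congr (_ - _).
  rewrite /tf_entry ifF; last lia.
  case: (ltnP n.-1 i.+1) => il.
    have -> : (i == n.-1 :> nat)%N by have := ltn_ord i; lia.
    rewrite ifF; last lia.
    have -> : (i.+1 - n + 1 = 1)%N by have := ltn_ord i; lia.
    suff -> : sigma k 1 = 1%N by [].
    by elim: (k) => //= m IH; rewrite big_nat1.
  rewrite ifT; last lia.
  by have -> : (i == n.-1 :> nat)%N = false by [lia]; rewrite !mul0r.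
have n0 : (0 < n)%N by lia.
have n1 : (1 < n)%N by lia.
have s0 : \sum_(i < n) dd i = 0.
  have := polar (Ordinal n0) isT; rewrite /dot.
  under eq_bigr => i _ do rewrite dE !mxE /tf_entry /= expr0 divr1 mulr1.
  by rewrite -mulr_suml => /eqP; rewrite mulf_eq0 invr_eq0 (negPf nk0) orbF => /eqP.
have s1 : \sum_(i < n) dd i * i.+1%:R = 0.
  have jk : (Ordinal n1 <= k)%N by rewrite /=; lia.
  have := polar _ jk; rewrite /dot.
  under eq_bigr => i _ do
    rewrite dE !mxE /tf_entry /= ltnS (leq_trans _ k2) // subSS subn0 !expr1 mulrA (mulrAC (dd i)).
  rewrite -!mulr_suml => /eqP; rewrite !mulf_eq0 !invr_eq0 (negPf nk0) (negPf nR0) !orbF.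
  by move/eqP.
have s2 : \sum_(i < n) g i * (n - i.+1)%:R = 0.
  transitivity (n%:R * (\sum_(i < n) dd i) - \sum_(i < n) dd i * i.+1%:R);
    last by rewrite s0 s1 mulr0 subr0.
  rewrite mulr_sumr -sumrB.
  apply: eq_bigr => i _; rewrite (mulrC n%:R) -mulrBr -natrB //.
  rewrite /dd mulrBl; case: eqP => [->|_]; last by rewrite !mul0r subr0.
  by rewrite prednK // subnn !mulr0 subr0.
have g0 i : 0 <= g i by rewrite /g; case: ifP => // _; rewrite exprn_ge0.
have q1 : uphalf k = 1%N.
  apply: contrapT => q1.
  have l2 : (n.-2 < n)%N by lia.
  move/eqP: s2; rewrite psumr_eq0; last by move=> i _; rewrite mulr_ge0.
  move=> /allP /(_ (Ordinal l2) (mem_index_enum _)) /=.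
  rewrite mulf_eq0 pnatr_eq0 orbC /g ifT; last lia.
  rewrite expf_eq0 pnatr_eq0; lia.
have k2' : k = 2%N by lia.
move: s0; subst k; rewrite /dd sumrB.
rewrite (bigD1 l) //= [X in _ + X - _]big1 ?addr0; last first.
  move=> i il; rewrite /g ifF //.
  by have : i != n.-1 :> nat by [exact: il]; have := ltn_ord i; rewrite /=; lia.
rewrite (bigD1 l) //= [X in - (_ + X)]big1 ?addr0; last first.
  by move=> i /negPf il; rewrite [(_ == _)%N]il mul0r.
rewrite eqxx mul1r /g /= ifT; last lia.
have -> : (n.-1 - (n - 2) = 1)%N by lia.
rewrite expr1n (_ : 2`! = 2%N) //; lra.
Qed.

(** * Smooth bump functions *)

(** The family [P / w^m exp(-1/w)] on [w > 0] is stable under differentiation;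
    smoothness of the bump follows without computing any higher derivative. *)
Definition poly_bump (R : realType) (w P : {poly R}) (m : nat) (x : R) : R :=
  if 0 < w.[x] then P.[x] / w.[x] ^+ m * expR (- (w.[x])^-1) else 0.

(** At the boundary of the support the difference quotient is at most
    [M |y - x|]. *)
Lemma is_derive0_quadratic (R : realType) (F : R -> R) (x M : R) :
  F x = 0 -> (forall y, `|y - x| <= 1 -> `|F y| <= M * (y - x) ^+ 2) ->
  is_derive x 1 F 0.
Proof.
move=> Fx FM; apply/is_derive1_caratheodory.
exists (fun z => F z / (z - x)); split; last by rewrite Fx mul0r.
- move=> z; rewrite Fx subr0; have [->|zx] := eqVneq z x; first by rewrite Fx mul0r mul0r.
  by rewrite divfK // subr_eq0.
- have FM' y : `|y - x| <= 1 -> `|F y / (y - x)| <= `|M| * `|y - x|.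
    move=> yx; have [->|nyx] := eqVneq y x; first by rewrite Fx mul0r normr0 mulr_ge0.
    have yx0 : 0 < `|y - x| by rewrite normr_gt0 subr_eq0.
    rewrite normrM normfV ler_pdivrMr //.
    apply: le_trans (FM _ yx) _; rewrite -mulrA -expr2 real_normK ?num_real //.
    by rewrite ler_wpM2r ?sqr_ge0 // ler_norm.
  apply/cvgrPdist_le => e e0; near=> y.
  rewrite Fx mul0r sub0r normrN.
  have y1 : `|y - x| <= 1.
    by rewrite distrC; near: y; apply: cvgr_dist_le; [exact: cvg_id | exact: ltr01].
  apply: le_trans (FM' _ y1) _.
  have ye : `|y - x| <= e / (`|M| + 1).
    rewrite distrC; near: y; apply: cvgr_dist_le; first exact: cvg_id.
    by rewrite divr_gt0 // ltr_wpDl.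
  have M0 : 0 < `|M| + 1 by rewrite ltr_wpDl.
  apply: (@le_trans _ _ (`|M| * (e / (`|M| + 1)))); first by rewrite ler_wpM2l.
  by rewrite mulrA ler_pdivrMr // mulrC ler_wpM2l ?(ltW e0) // lerDl.
Unshelve. all: by end_near. Qed.

(** From [exp(1/w) >= w^-(m+2) / (m+2)!] the bump is at most a multiple of [w^2],
    and [w] is at most a multiple of [|y - x|] because [w x <= 0]. *)
Lemma poly_bump_quadratic (R : realType) (w P : {poly R}) m x :
  w.[x] <= 0 -> exists M, forall y, `|y - x| <= 1 ->
    `|poly_bump w P m y| <= M * (y - x) ^+ 2.
Proof.
move=> wx.
have /factor_theorem[q qE] : root (w - (w.[x])%:P) x by rewrite /root !hornerE subrr.
have [B PB] := poly_itv_bound P (x - 1) (x + 1).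
have [L qL] := poly_itv_bound q (x - 1) (x + 1).
exists (`|B| * m.+2`!%:R * L ^+ 2) => y yx.
have yI : x - 1 <= y <= x + 1 by rewrite -ler_distl.
rewrite /poly_bump; case: ifPn => [wy|_]; last first.
  by rewrite normr0 mulr_ge0 ?sqr_ge0 // mulr_ge0 ?sqr_ge0 // mulr_ge0.
have wyE : w.[y] - w.[x] = q.[y] * (y - x).
  by have /(congr1 (horner ^~ y)) := qE; rewrite !hornerE.
have wyL : w.[y] <= L * `|y - x|.
  apply: (@le_trans _ _ (w.[y] - w.[x])); first by rewrite lerDl oppr_ge0.
  rewrite wyE; apply: le_trans (ler_norm _) _; rewrite normrM ler_wpM2r //.
  exact: qL.
have expw : expR (- (w.[y])^-1) <= m.+2`!%:R * w.[y] ^+ m.+2.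
  have v0 : 0 <= (w.[y])^-1 by rewrite invr_ge0 ltW.
  have f0 : 0 < m.+2`!%:R :> R by rewrite ltr0n fact_gt0.
  have wm0 : 0 < w.[y] ^+ m.+2 by rewrite exprn_gt0.
  rewrite expRN -[leLHS]mul1r ler_pdivrMr ?expR_gt0 //.
  have {1}-> : 1 = m.+2`!%:R * w.[y] ^+ m.+2 * ((w.[y])^-1 ^+ m.+2 / m.+2`!%:R).
    by rewrite exprVn; field; rewrite !gt_eqF.
  apply: ler_wpM2l; first exact: mulr_ge0 (ltW f0) (ltW wm0).
  by have := expR_ge1Dxn m.+1 v0; apply: le_trans; rewrite lerDr.
rewrite !normrM normfV (ger0_norm (expR_ge0 _)) (ger0_norm (exprn_ge0 _ (ltW wy))).
apply: (@le_trans _ _ (`|B| / w.[y] ^+ m * (m.+2`!%:R * w.[y] ^+ m.+2))).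
  rewrite ler_pM ?expR_ge0 ?divr_ge0 ?exprn_ge0 ?(ltW wy) //.
  rewrite ler_wpM2r ?invr_ge0 ?exprn_ge0 ?(ltW wy) //.
  by apply: le_trans (PB _ yI) (ler_norm _).
have -> : `|B| / w.[y] ^+ m * (m.+2`!%:R * w.[y] ^+ m.+2) =
    `|B| * m.+2`!%:R * w.[y] ^+ 2.
  by rewrite -(addn2 m) exprD; field; rewrite expf_neq0 ?gt_eqF.
rewrite -[leRHS]mulrA ler_wpM2l ?mulr_ge0 //.
rewrite -(real_normK (num_real (y - x))) -exprMn lerXn2r ?nnegrE ?(ltW wy) //.
by apply: le_trans wyL; exact: ltW.
Qed.

Lemma is_derive_poly_bump (R : realType) (w P : {poly R}) m (x : R) :
  is_derive x 1 (poly_bump w P m)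
    (poly_bump w (P^`() * w ^+ 2 - m%:R *: (P * w^`() * w) + P * w^`()) m.+2 x).
Proof.
have [wx|wx] := ltrP 0 w.[x]; last first.
  have [M PM] := poly_bump_quadratic P m wx.
  have p0 P' m' : poly_bump w P' m' x = 0 by rewrite /poly_bump ltNge wx.
  by rewrite p0; apply: is_derive0_quadratic PM.
apply: (@near_eq_is_derive _ _ _ (fun y => P.[y] * (w.[y] ^+ m)^-1 * expR (- (w.[y])^-1))).
  near=> y; rewrite /poly_bump ifT //; near: y.
  by apply: (cvgr_gt w.[x]) => //; exact: continuous_horner.
have w0 : w.[x] != 0 by rewrite gt_eqF.
have dV : is_derive x 1 (fun y => (w.[y])^-1) (- w.[x] ^- 2 *: w^`().[x]).
  exact: (@is_deriveV _ (horner w)).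
have dX : is_derive x 1 (fun y => w.[y] ^+ m) (m%:R * w.[x] ^+ m.-1 *: w^`().[x]).
  have -> : (fun y => w.[y] ^+ m) = horner (w ^+ m).
    by apply/funext => y; rewrite horner_exp.
  apply: (is_derive_eq (is_derive_poly (w ^+ m) x)).
  by rewrite deriv_exp hornerMn hornerM horner_exp /GRing.scale /= -[LHS]mulr_natl; ring.
have dVm : is_derive x 1 (fun y => (w.[y] ^+ m)^-1)
  (- (w.[x] ^+ m) ^- 2 *: (m%:R * w.[x] ^+ m.-1 *: w^`().[x])).
  by apply: (@is_deriveV _ (fun y => w.[y] ^+ m)) => //; rewrite expf_neq0.
have dE : is_derive x 1 (fun y => expR (- (w.[y])^-1))
   (expR (- (w.[x])^-1) * - (- w.[x] ^- 2 *: w^`().[x])).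
  apply: (@is_derive1_comp _ expR (fun y => - (w.[y])^-1)).
have dPV := is_deriveM (is_derive_poly P x) dVm.
apply: (is_derive_eq (is_deriveM dPV dE)).
rewrite /poly_bump wx !hornerE fctE /GRing.scale /=.
move: (P^`().[x]) (w^`().[x]) (expR _) => P' w' e.
case: m {dX dVm dPV} => [|m] /=; first by field.
rewrite !exprS; have wm0 : w.[x] ^+ m != 0 by rewrite expf_neq0.
by field; rewrite w0 wm0.
Unshelve. all: by end_near. Qed.

Lemma derive1n_poly_bump (R : realType) (w P : {poly R}) m n :
  exists P' m', derive1n n (poly_bump w P m) = poly_bump w P' m'.
Proof.
elim: n => [|n [P' [m' IH]]]; first by exists P, m.
exists (P'^`() * w ^+ 2 - m'%:R *: (P' * w^`() * w) + P' * w^`()), m'.+2.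
rewrite derive1nS IH; apply/funext => x.
by have := is_derive_poly_bump w P' m' x; rewrite derive1E => -[_ ->].
Qed.

Definition interval_bump (R : realType) (a b : R) : R -> R :=
  poly_bump (('X - a%:P) * (b%:P - 'X)) 1 0.

Lemma interval_bump_gt0 (R : realType) (a b x : R) :
  a < x < b -> 0 < interval_bump a b x.
Proof.
move=> /andP[ax xb]; rewrite /interval_bump /poly_bump.
rewrite ifT; last by rewrite !hornerE mulr_gt0 ?subr_gt0.
by rewrite hornerC expr0 divr1 mul1r expR_gt0.
Qed.

Lemma interval_bump_eq0 (R : realType) (a b x : R) :
  a < b -> ~~ (a < x < b) -> interval_bump a b x = 0.
Proof.
move=> ab /negP xab; rewrite /interval_bump /poly_bump ifF // !hornerE.
by apply/negP => w0; apply: xab; apply/andP; split; nra.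
Qed.

Lemma interval_bump_test (R : realType) (a b : R) : 0 < a -> a < b -> b < 1 ->
  test_function (interval_bump a b).
Proof.
move=> a0 ab b1; split.
  move=> m x; rewrite /interval_bump.
  have [P' [m' ->]] := derive1n_poly_bump (('X - a%:P) * (b%:P - 'X)) 1 0 m.
  by have [] := is_derive_poly_bump (('X - a%:P) * (b%:P - 'X)) P' m' x.
exists a, b; split => // x xab; apply: interval_bump_eq0 => //.
by apply: contraNN xab => /andP[ax xb]; rewrite !ltW.
Qed.

Section TestFunctions.
Variable R : realType.
Implicit Types phi f : R -> R.
Notation mu := (@lebesgue_measure R).

Lemma test_function_derive phi : test_function phi -> test_function (derive1 phi).
Proof.
move=> [dphi [a [b [a0 b1 phi0]]]]; split.
  by move=> m x; have := dphi m.+1 x; rewrite /derive1n iterSr.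
exists a, b; split=> // x xab; rewrite derive1E.
rewrite (@near_eq_derive _ _ _ _ (cst 0)) ?derive_cst //.
move: xab; rewrite negb_and -!ltNge => /orP[xa|bx].
- near=> y; apply: phi0; rewrite negb_and -!ltNge; apply/orP; left.
  by near: y; exact: lt_nbhsl.
- near=> y; apply: phi0; rewrite negb_and -!ltNge; apply/orP; right.
  by near: y; exact: lt_nbhsr.
Unshelve. all: by end_near. Qed.

Lemma test_function_derive1n n phi : test_function phi -> test_function (derive1n n phi).
Proof.
by move=> tphi; elim: n => // n IH; rewrite derive1nS; exact: test_function_derive.
Qed.

Lemma test_function_continuous phi : test_function phi -> continuous phi.
Proof.
by move=> [/(_ 0%N) dphi _] x; apply/differentiable_continuous/derivable1_diffP/dphi.
Qed.

Lemma test_function01 phi : test_function phi -> phi 0 = 0 /\ phi 1 = 0.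
Proof.
move=> [_ [a [b [a0 b1 phi0]]]]; split; apply: phi0.
  by rewrite negb_and -!ltNge a0.
by rewrite negb_and -!ltNge b1 orbT.
Qed.

Lemma integrable_mul_test f phi : locally_integrable `]0, 1[ f ->
  test_function phi -> mu.-integrable `]0, 1[ (EFin \o (fun x => f x * phi x)).
Proof.
move=> [mf _ lf] tphi; have cphi := test_function_continuous tphi.
have [_ [a [b [a0 b1 phi0]]]] := tphi.
have ab01 : `[a, b] `<=` `]0, 1[%classic.
  by apply: subset_itv; rewrite bnd_simp.
have iab : mu.-integrable `[a, b] (EFin \o f).
  apply/integrableP; split; last exact: lf (@segment_compact _ a b).
  by apply/measurable_EFinP; apply: measurable_funS mf.
have : mu.-integrable `[a, b] ((EFin \o f) \* (EFin \o phi))%E.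
  apply: integrableMl => //.
  - by apply: measurable_funTS; exact: continuous_measurable_fun.
  - have /compact_bounded[M [Mr PM]] := continuous_compact
      (continuous_subspaceT cphi) (@segment_compact _ a b).
    by exists M; split => // y My x xab; apply: PM => //; exists x.
move=> iabp; have [h _] := @integrable_mkcond _ _ _ mu `[a, b]%classic
  ((EFin \o f) \* (EFin \o phi))%E (measurable_itv _).
apply/integrable_mkcond => //; move: {h}(h iabp) => h.
apply: eq_integrable h => // x _; rewrite !patchE /=.
case: ifPn => [xab|xab]; first by rewrite ifT //; move: xab; rewrite !inE; exact: ab01.
case: ifPn => // _; rewrite phi0 ?mulr0 //.
by apply: contra xab; rewrite inE /= in_itv.
Qed.

(** If [h = g1 - g2] is nonzero at [x], right-continuity keeps [h x * h] positive
    on some interval starting at [x]; the integral of [h x * h] against a bump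
    supported there would be positive. *)
Lemma weak_eq_right_continuous g1 g2 :
  locally_integrable `]0, 1[ g1 -> locally_integrable `]0, 1[ g2 ->
  (forall phi, test_function phi ->
     \int[mu]_(x in `]0, 1[) (g1 x * phi x) = \int[mu]_(x in `]0, 1[) (g2 x * phi x)) ->
  (forall x, 0 < x < 1 -> g1 z @[z --> x^'+] --> g1 x) ->
  (forall x, 0 < x < 1 -> g2 z @[z --> x^'+] --> g2 x) ->
  forall x, 0 < x < 1 -> g1 x = g2 x.
Proof.
move=> l1 l2 g12 r1 r2 x /andP[x0 x1]; apply: contrapT => ne.
pose h y := g1 y - g2 y.
have hx0 : h x != 0 by rewrite subr_eq0; apply/eqP.
have rh : h z @[z --> x^'+] --> h x by apply: cvgB; [apply: r1|apply: r2]; rewrite x0.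
have : \forall z \near x^'+, 0 < h x * h z.
  have c2 : h x * h z @[z --> x^'+] --> h x * h x by apply: cvgMr.
  by apply: (cvgr_gt _ c2); rewrite -expr2 exprn_even_gt0.
move=> [e /= e0 he].
(* The support of the bump must stay below 1. *)
pose b := Num.min (x + e / 2) ((x + 1) / 2).
have xb : x < b by rewrite lt_min; apply/andP; split; lra.
have be : b <= x + e / 2 by rewrite ge_min lexx.
have b1 : b < 1 by rewrite gt_min; apply/orP; right; lra.
pose phi := interval_bump x b.
have tphi : test_function phi by exact: interval_bump_test.
have lh : locally_integrable `]0, 1[ h by exact: locally_integrableB.
have ih := integrable_mul_test lh tphi.
have I0 : \int[mu]_(y in `]0, 1[) (h y * phi y) = 0.
  under eq_Rintegral do rewrite mulrBl.
  rewrite RintegralB //; [|exact: integrable_mul_test..].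
  by rewrite g12 // subrr.
have pos y : 0 <= h x * (h y * phi y).
  have [xyb|xyb] := boolP (x < y < b); last by rewrite /phi interval_bump_eq0 ?mulr0.
  have /ltW p0 := interval_bump_gt0 xyb; move/andP: xyb => [xy yb].
  rewrite mulrA mulr_ge0 // ltW //; apply: he => //=.
  by rewrite ltr_distl; apply/andP; split; lra.
have ihx : mu.-integrable `]0, 1[ (EFin \o (fun y => h x * (h y * phi y))).
  have := integrableZl _ (h x) ih; apply; exact: measurable_itv.
have I1 : (\int[mu]_(y in `]0%R, 1%R[) (h x * (h y * phi y))%:E = 0)%E.
  have : \int[mu]_(y in `]0, 1[) (h x * (h y * phi y)) = 0 by rewrite RintegralZl // I0 mulr0.
  rewrite /Rintegral => E.
  rewrite -[LHS]fineK; first by rewrite E.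
  apply: integrable_fin_num; first exact: measurable_itv.
  exact: ihx.
have ae0 : ae_eq mu (`]0, 1[%classic : set R) (fun y => (h x * (h y * phi y))%:E) (cst 0%E).
  apply/ae_eq_integral_abs => //; first by case/integrableP: ihx.
  by under eq_integral => y _ do rewrite gee0_abs ?lee_fin ?pos //.
have neg : mu.-negligible `]x, b[%classic.
  apply: negligibleS ae0 => y /=; rewrite in_itv /= => /andP[xy yb].
  have y01 : y \in `]0, 1[ by rewrite in_itv /=; apply/andP; split; lra.
  move=> /(_ y01) [] /eqP; apply/negP; rewrite gt_eqF //.
  rewrite mulrA mulr_gt0 ?interval_bump_gt0 ?xy //; apply: he => //=.
  by rewrite ltr_distl; apply/andP; split; lra.
have : mu `]x, b[%classic = 0%E.
  by apply: measure_negligible neg; exact: measurable_itv.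
rewrite lebesgue_measure_itv /= lte_fin xb => /eqP.
by rewrite -EFinB eqe subr_eq0 gt_eqF.
Qed.

End TestFunctions.

(** * Weak derivatives of splines *)

Section WeakDerivative.
Variable R : realType.
Implicit Types (phi f g : R -> R) (q : {poly R}).
Notation mu := (@lebesgue_measure R).

Lemma derivable_LRcontinuous f a b :
  (forall x, derivable f x 1) -> derivable_oo_LRcontinuous f a b.
Proof.
move=> df; have cf x : {for x, continuous f}.
  exact/differentiable_continuous/derivable1_diffP/df.
split; first by move=> x _; exact: df.
- exact/cvg_at_right_filter/cf.
- exact/cvg_at_left_filter/cf.
Qed.

(** Integration by parts [k] times: the boundary terms vanish at 1 because of the
    test function, and at [t] because of the test function if [t = 0], of the
    polynomial otherwise. *)
Lemma poly_by_parts k q phi (t : R) : t < 1 -> test_function phi ->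
  (t = 0 \/ forall d, (d < k)%N -> (derivn d q).[t] = 0) ->
  \int[mu]_(x in `[t, 1]) (q.[x] * derive1n k phi x) =
  (-1) ^+ k * \int[mu]_(x in `[t, 1]) ((derivn k q).[x] * phi x).
Proof.
move=> t1 tphi; elim: k q => [|k IH] q bnd; first by rewrite expr0 mul1r.
have tphik := test_function_derive1n k tphi.
have [phi0 phi1] := test_function01 tphik.
rewrite (@Rintegration_by_parts _ (horner q) (derive1n k phi) (horner q^`())
  (derive1n k.+1 phi)) //; first last.
- by apply: derivable_LRcontinuous; case: tphik => /(_ 0%N).
- apply: continuous_subspaceT; apply: test_function_continuous.
  exact: test_function_derive1n.
- by move=> x _; rewrite derivE.
- by apply: derivable_LRcontinuous => x; exact: derivable_horner.
- by apply: continuous_subspaceT; exact: continuous_horner.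
rewrite IH; last by case: bnd => [|bnd]; [left | right => d dk; rewrite -derivSn; exact: bnd].
have -> : q.[t] * derive1n k phi t = 0.
  by case: bnd => [->|/(_ 0%N isT) q0]; [rewrite phi0 mulr0 | rewrite [q.[t]]q0 mul0r].
by rewrite phi1 mulr0 subrr sub0r exprS mulN1r mulNr derivSn.
Qed.

Definition trunc_poly q (t x : R) : R := q.[x] * (t <= x)%R%:R.

Lemma integrable_trunc_poly q t : mu.-integrable `]0, 1[ (EFin \o trunc_poly q t).
Proof.
have pieceE : trunc_poly q t = (fun x => q.[x] * \1_(`[t, +oo[%classic) x).
  by apply/funext => x; rewrite /trunc_poly indicE mem_setE in_itv /= andbT.
apply: measurable_bounded_integrable => //.
- by rewrite /= lebesgue_measure_itv /= lte_fin ltr01 -EFinB ltry.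
- rewrite pieceE; apply: measurable_funM.
    by apply: measurable_funTS; apply: continuous_measurable_fun; exact: continuous_horner.
  by apply: measurable_funTS; exact: measurable_indic.
- have [B qB] := poly_itv_bound q 0 1.
  exists B; split; rewrite ?num_real // => y By x /=; rewrite in_itv /= => /andP[x0 x1].
  apply: le_trans (ltW By); apply: le_trans (qB x _); last by rewrite !ltW.
  by rewrite /trunc_poly normrM ler_piMr // normr_nat lern1; case: (_ <= _).
Qed.

Lemma locally_integrable_trunc_poly q t : locally_integrable `]0, 1[ (trunc_poly q t).
Proof.
by apply: open_integrable_locally; [exact: interval_open | exact: integrable_trunc_poly].
Qed.

Lemma integral_trunc_poly q t phi : 0 <= t < 1 -> phi 0 = 0 -> phi 1 = 0 ->
  \int[mu]_(x in `]0, 1[) (trunc_poly q t x * phi x) =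
  \int[mu]_(x in `[t, 1]) (q.[x] * phi x).
Proof.
move=> /andP[t0 t1] p0 p1; rewrite Rintegral_mkcond [RHS]Rintegral_mkcond.
apply: eq_Rintegral => x _; rewrite !patchE /trunc_poly !mem_setE !in_itv /=.
case: (ltP 0 x) => x0; case: (ltgtP x 1) => x1; case: (leP t x) => tx //=;
  rewrite ?(mulr0, mulr1, mul0r) //; rewrite ?x1 ?p1 ?mulr0 //; try lra.
have -> : x = 0 by lra.
by rewrite p0 mulr0.
Qed.

Lemma weak_derivative_trunc_poly k q t : 0 <= t < 1 ->
  (t = 0 \/ forall d, (d < k)%N -> (derivn d q).[t] = 0) ->
  weak_derivative k (trunc_poly q t) (trunc_poly (derivn k q) t).
Proof.
move=> t01 bnd; split; [exact: locally_integrable_trunc_poly..|] => phi tphi.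
have [p0 p1] := test_function01 tphi.
have [pk0 pk1] := test_function01 (test_function_derive1n k tphi).
rewrite !integral_trunc_poly //; apply: poly_by_parts => //.
by case/andP: t01.
Qed.

Lemma weak_derivativeD k f1 g1 f2 g2 :
  weak_derivative k f1 g1 -> weak_derivative k f2 g2 ->
  weak_derivative k (f1 \+ f2) (g1 \+ g2).
Proof.
move=> [lf1 lg1 w1] [lf2 lg2 w2]; split; [exact: locally_integrableD..|].
move=> phi tphi; have tphik := test_function_derive1n k tphi.
under eq_Rintegral do rewrite mulrDl.
under [in RHS]eq_Rintegral do rewrite mulrDl.
by rewrite !RintegralD ?w1 ?w2 ?mulrDr //; exact: integrable_mul_test.
Qed.

Lemma weak_derivative_sum k (q : nat -> {poly R}) (t : nat -> R) m :
  (forall l, (l < m)%N -> 0 <= t l < 1 /\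
     (t l = 0 \/ forall d, (d < k)%N -> (derivn d (q l)).[t l] = 0)) ->
  weak_derivative k (fun x => \sum_(0 <= l < m) trunc_poly (q l) (t l) x)
                    (fun x => \sum_(0 <= l < m) trunc_poly (derivn k (q l)) (t l) x).
Proof.
elim: m => [|m IH] h.
  have E : (fun x => \sum_(0 <= l < 0) trunc_poly (q l) (t l) x) = trunc_poly 0 0.
    by apply/funext => x; rewrite big_geq // /trunc_poly horner0 mul0r.
  have E' : (fun x => \sum_(0 <= l < 0) trunc_poly (derivn k (q l)) (t l) x) =
      trunc_poly (derivn k 0) 0.
    by apply/funext => x; rewrite big_geq // /trunc_poly linear0 horner0 mul0r.
  by rewrite E E'; apply: weak_derivative_trunc_poly; [rewrite lexx ltr01 | left].
have [tm bm] := h m (ltnSn m).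
have h' l : (l < m)%N -> 0 <= t l < 1 /\
     (t l = 0 \/ forall d, (d < k)%N -> (derivn d (q l)).[t l] = 0).
  by move=> lm; apply: h; exact: ltnW.
have := weak_derivativeD (IH h') (weak_derivative_trunc_poly tm bm).
by congr (weak_derivative k _ _); apply/funext => x; rewrite /= big_nat_recr.
Qed.

Lemma locally_integrable_ext f f' : (forall x, 0 < x < 1 -> f x = f' x) ->
  locally_integrable `]0, 1[ f -> locally_integrable `]0, 1[ f'.
Proof.
move=> ff' [mf oI lf].
have E : {in `]0, 1[%classic, f =1 f'}.
  by move=> x; rewrite mem_setE in_itv /=; exact: ff'.
split => //; first by apply: eq_measurable_fun mf.
move=> K KI cK; apply: le_lt_trans (lf K KI cK).
rewrite le_eqVlt; apply/orP; left; apply/eqP.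
apply: eq_integral => x; rewrite inE => Kx; rewrite ff' //.
by have := KI _ Kx; rewrite /= in_itv.
Qed.

Lemma weak_derivative_ext k f f' g g' : (forall x, 0 < x < 1 -> f x = f' x) ->
  (forall x, 0 < x < 1 -> g x = g' x) ->
  weak_derivative k f g -> weak_derivative k f' g'.
Proof.
move=> ff' gg' [lf lg w]; split;
  [exact: locally_integrable_ext lf|exact: locally_integrable_ext lg|].
move=> phi tphi; transitivity (\int[mu]_(x in `]0, 1[) (f x * derive1n k phi x)).
  by apply: eq_Rintegral => x; rewrite mem_setE in_itv /= => /ff' ->.
rewrite w //; congr (_ * _).
by apply: eq_Rintegral => x; rewrite mem_setE in_itv /= => /gg' ->.
Qed.

(** Two weak derivatives agree on the open interval, and the one-sided limits
    required of the representative extend this to 0 and 1. *)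
Lemma kth_derivative_eq k f g : (0 < k)%N -> weak_derivative k f g ->
  (forall x, 0 <= x < 1 -> g z @[z --> x^'+] --> g x) ->
  g z @[z --> 1^'-] --> g 1 ->
  forall x, 0 <= x <= 1 -> kth_derivative k f x = g x.
Proof.
move=> k0 wg rg lg; rewrite /kth_derivative eqn0Ngt k0 /=.
set P := [set h | _].
have : P (xget (fun=> 0) P) by apply: xgetPex; exists g; split.
move: (xget _ _) => h [[lf lh wh] rh llh].
case: wg => _ lg' wg'.
have gh x : 0 < x < 1 -> h x = g x.
  apply: weak_eq_right_continuous => //.
  - move=> phi tphi; have := wh _ tphi; rewrite wg' // => /mulfI E.
    by rewrite E // expf_neq0 // oppr_eq0 oner_eq0.
  - by move=> y /andP[y0 y1]; apply: rh; rewrite ltW.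
  - by move=> y /andP[y0 y1]; apply: rg; rewrite ltW.
move=> x /andP[]; rewrite le_eqVlt => /predU1P[<- _|x0].
  have /rh h0 : 0 <= (0 : R) < 1 by rewrite lexx ltr01.
  have /rg g0 : 0 <= (0 : R) < 1 by rewrite lexx ltr01.
  apply: (@cvg_unique _ _ (h z @[z --> 0^'+]) _ _ _ h0) => //.
  apply: cvg_trans g0; apply: near_eq_cvg.
  near=> y; rewrite gh //; apply/andP; split; near: y.
  - exact: nbhs_right_gt.
  - exact: nbhs_right_lt.
rewrite le_eqVlt => /predU1P[->|x1]; last by rewrite gh ?x0.
apply: (@cvg_unique _ _ (h z @[z --> 1^'-]) _ _ _ llh) => //.
apply: cvg_trans lg; apply: near_eq_cvg.
near=> y; rewrite gh //; apply/andP; split; near: y.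
- exact: nbhs_left_gt.
- exact: nbhs_left_lt.
Unshelve. all: by end_near. Qed.

End WeakDerivative.

(** * Total variation of step functions *)

Section StepFunction.
Variable R : realType.
Implicit Types (T : seq R) (c : nat -> R) (g : R -> R).

Lemma count_le_near_right T (x : R) :
  \forall z \near x^'+, count (fun t => t <= z) T = count (fun t => t <= x) T.
Proof.
elim: T => [|t T IH]; first by near=> z.
have tz : \forall z \near x^'+, (t <= z) = (t <= x).
  case: (leP t x) => tx; near=> z.
    by rewrite (le_trans tx) // ltW //; near: z; exact: nbhs_right_gt.
  by apply/negbTE; rewrite -ltNge; near: z; exact: nbhs_right_lt.
by near=> z; rewrite /=; congr (_ + _)%N; [congr nat_of_bool|]; near: z.
Unshelve. all: by end_near. Qed.

Lemma count_le_near_left T (x : R) : (forall t, t \in T -> t < x) ->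
  \forall z \near x^'-, count (fun t => t <= z) T = count (fun t => t <= x) T.
Proof.
elim: T => [|t T IH] Tx; first by near=> z.
have tx : t < x by apply: Tx; rewrite mem_head.
have {}IH := IH (fun u uT => Tx u (mem_behead (s := t :: T) uT)).
near=> z; rewrite /= (ltW tx).
have -> : t <= z by rewrite ltW //; near: z; exact: nbhs_left_gt.
by congr (_ + _)%N; near: z.
Unshelve. all: by end_near. Qed.

Lemma step_cvg_right T c (x : R) :
  c (count (fun t => t <= z) T) @[z --> x^'+] --> c (count (fun t => t <= x) T).
Proof.
apply: cvg_near_cst; apply: filterS (count_le_near_right T x) => z -> //.
Qed.

Lemma step_cvg_left T c (x : R) : (forall t, t \in T -> t < x) ->
  c (count (fun t => t <= z) T) @[z --> x^'-] --> c (count (fun t => t <= x) T).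
Proof.
move=> Tx; apply: cvg_near_cst; apply: filterS (count_le_near_left Tx) => z -> //.
Qed.

(** A function that is constant up to a final jump is monotone. *)
Lemma total_variation_jump g (a t : R) : a < t -> (forall x, a <= x < t -> g x = g a) ->
  total_variation a t g = `|g t - g a|%:E.
Proof.
move=> at_ ga.
have mono h : (forall x, a <= x < t -> h x = h a) -> h a <= h t ->
    total_variation a t h = `|h t - h a|%:E.
  move=> ha hat; rewrite nondecreasing_total_variation ?(ltW at_) //.
    by rewrite ger0_norm ?subr_ge0.
  move=> x y; rewrite !in_itv /= => /andP[ax xt] /andP[ay yt] xy.
  move: yt; rewrite le_eqVlt => /predU1P[->|yt].
    move: xt; rewrite le_eqVlt => /predU1P[->//|xt].
    by rewrite ha // ax.
  by rewrite !ha ?ax ?ay //; apply: le_lt_trans yt.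
case: (leP (g a) (g t)) => [|/ltW] gat; first exact: mono.
rewrite -total_variationN mono /=; first by rewrite -opprD normrN.
  by move=> x /ga ->.
by rewrite lerN2.
Qed.

Lemma total_variation_step T c g (a b : R) : path <%R a T ->
  (forall t, t \in T -> t <= b) -> a <= b ->
  (forall x, a <= x <= b -> g x = c (count (fun t => t <= x) T)) ->
  total_variation a b g = (\sum_(0 <= l < size T) `|c l.+1 - c l|)%:E.
Proof.
elim: T c a => [|t T IH] c a aT Tb ab gc.
  rewrite big_geq // nondecreasing_total_variation //.
    by rewrite !gc ?lexx ?ab // subrr.
  by move=> x y; rewrite !in_itv /= => xab yab _; rewrite !gc.
have tb : t <= b by apply: Tb; rewrite mem_head.
move: aT => /= /andP[at_ tT].
have Tt u : u \in T -> t < u by move: (order_path_min lt_trans tT) => /allP; apply.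
have cnt0 x : x <= t -> count (fun u => u <= x) T = 0%N.
  move=> xt; apply/eqP; rewrite -leqn0 leqNgt -has_count; apply/hasPn => u /Tt tu.
  by rewrite -ltNge (le_lt_trans xt).
rewrite (total_variationD _ (ltW at_) tb) (IH (c \o S) t) //; last 2 first.
- by move=> u uT; apply: Tb; rewrite inE uT orbT.
- by move=> x /andP[tx xb]; rewrite gc ?(le_trans (ltW at_)) //= tx.
have ga x : a <= x < t -> g x = c 0%N.
  move=> /andP[ax xt]; rewrite gc /= ?ax ?(le_trans (ltW xt)) //.
  by rewrite leNgt xt /= cnt0 // ltW.
rewrite total_variation_jump //; last by move=> x axt; rewrite !ga // lexx.
rewrite (ga a) ?lexx // gc ?(ltW at_) //= lexx cnt0 // addn0.
by rewrite -EFinD big_nat_recl.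
Qed.

End StepFunction.

(** * Splines in coordinates *)

Section SplinePolynomials.
Variable R : realType.
Implicit Types (p q : {poly R}) (a : R).

Lemma derivn_expXsubC a k d :
  derivn d (('X - a%:P) ^+ k) = ('X - a%:P) ^+ (k - d) *+ (k ^_ d).
Proof.
elim: d => [|d IH]; first by rewrite subn0 ffactn0.
rewrite derivnS IH derivMn deriv_exp derivXsubC mul1r -mulrnA subnS ffactnSr.
by rewrite mulnC.
Qed.

Lemma poly_flat_eq0 k q a : (size q <= k)%N ->
  (forall d, (d < k)%N -> (derivn d q).[a] = 0) -> q = 0.
Proof.
elim: k q => [|k IH] q qk qa; first by apply/eqP; rewrite -size_poly_eq0 -leqn0.
have q'0 : q^`() = 0.
  apply: IH => [|d dk]; last by rewrite -derivSn qa.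
  by apply: leq_trans (size_poly _ _) _; lia.
have qC : q = (q`_0)%:P.
  apply/polyP => -[|i]; first by rewrite coefC.
  rewrite coefC /=; have := coef_deriv q i; rewrite q'0 coef0 => /esym/eqP.
  by rewrite -mulr_natr mulf_eq0 pnatr_eq0 orbF => /eqP.
by have := qa 0%N isT; rewrite derivn0 qC hornerC => ->.
Qed.

(** Subtracting the multiple of [('X - a)^k] with the same top coefficient leaves a
    polynomial of degree less than [k] that vanishes at [a] to order [k]. *)
Lemma poly_power_of_flat k q a : (size q <= k.+1)%N ->
  (forall d, (d < k)%N -> (derivn d q).[a] = 0) -> q = q`_k *: ('X - a%:P) ^+ k.
Proof.
move=> qk qa; apply/eqP; rewrite -subr_eq0; apply/eqP.
have lead : (('X - a%:P) ^+ k)`_k = 1.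
  have /monicP := monic_exp k (monicXsubC a).
  by rewrite lead_coefE size_exp_XsubC.
apply: (@poly_flat_eq0 k _ a).
  apply/leq_sizeP => j; rewrite leq_eqVlt => /predU1P[<-|kj].
    by rewrite coefB coefZ lead mulr1 subrr.
  have /leq_sizeP -> // : (size (q - q`_k *: ('X - a%:P) ^+ k)%R <= k.+1)%N.
  rewrite (leq_trans (size_polyD _ _)) // geq_max qk size_polyN.
  by rewrite (leq_trans (size_scale_leq _ _)) // size_exp_XsubC.
move=> d dk; rewrite derivnB derivnZ hornerD hornerN hornerZ qa // derivn_expXsubC.
rewrite hornerMn horner_exp !hornerE subrr expr0n.
have -> : (k - d == 0)%N = false by lia.
by rewrite mul0rn mulr0 oppr0.
Qed.

End SplinePolynomials.

Section SplineCoordinates.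
Variables (R : realType) (k n : nat).
Hypothesis hn : (k + 2 <= n)%N.
Notation T := (knots R k n).
Notation m := (n - k.+1)%N.
Implicit Types (theta : 'cV[R]_n).

Let t l : R := input R n (k - uphalf k + 2 + l).

Lemma knotsE : T = [seq t l | l <- iota 0 m].
Proof.
have E b : b = (k - uphalf k + 2)%N -> [seq t l | l <- iota 0 m] =
    [seq input R n i | i <- iota b m].
  by move=> ->; rewrite -(addn0 (k - uphalf k + 2)%N) iotaDl -map_comp.
rewrite /knots /index_iota; case: ifP => ok.
  by rewrite (E (k./2 + 2)%N); [congr (map _ (iota _ _)); lia | lia].
by rewrite (E (k.+1./2 + 1)%N); [congr (map _ (iota _ _)); lia | lia].
Qed.

Lemma size_knots : size T = m.
Proof. by rewrite knotsE size_map size_iota. Qed.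

Lemma nth_knots l : (l < m)%N -> nth 0 T l = t l.
Proof. by move=> lm; rewrite knotsE (nth_map 0%N) ?size_iota // nth_iota. Qed.

Let n0 : 0 < n%:R :> R.
Proof. by rewrite ltr0n; lia. Qed.

Lemma input_lt i j : (input R n i < input R n j) = (i < j)%N.
Proof. by rewrite /input ltr_pM2r ?invr_gt0 // ltr_nat. Qed.

Lemma input_le i j : (input R n i <= input R n j) = (i <= j)%N.
Proof. by rewrite /input ler_pM2r ?invr_gt0 // ler_nat. Qed.

Lemma input0 : input R n 0 = 0.
Proof. by rewrite /input mul0r. Qed.

Lemma inputn : input R n n = 1.
Proof. by rewrite /input divff // gt_eqF. Qed.

Lemma knots_gt0 u : u \in T -> 0 < u.
Proof. by rewrite knotsE => /mapP[l _ ->]; rewrite -input0 input_lt; lia. Qed.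

Lemma knots_le1 u : u \in T -> u <= 1.
Proof.
by rewrite knotsE => /mapP[l]; rewrite mem_iota => lm ->; rewrite -inputn input_le; lia.
Qed.

Lemma knots_lt1 u : (0 < k)%N -> u \in T -> u < 1.
Proof.
move=> k0; rewrite knotsE => /mapP[l]; rewrite mem_iota => lm ->.
by rewrite -inputn input_lt; lia.
Qed.

Lemma knots_path : path <%R 0 T.
Proof.
rewrite path_min_sorted; last by apply/allP => u; exact: knots_gt0.
rewrite knotsE; apply: (homo_sorted (e := ltn)); last exact: iota_ltn_sorted.
by move=> i j ij; rewrite input_lt ltn_add2l.
Qed.

Lemma knots_count l x : (l < m)%N -> (t l <= x) = (l < count (fun u => u <= x)%R T)%N.
Proof.
move=> lm; have sT : sorted <=%R T.
  by apply: sub_sorted (path_sorted knots_path) => u v /ltW.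
rewrite -nth_knots //; case: (ltnP l (count _ _)) => lc.
  by apply: nth_count_le.
apply/negbTE; rewrite -ltNge; apply: nth_count_gt => //.
by rewrite lc size_knots.
Qed.

(** The polynomial piece of index [l] of the spline with coordinates [theta] in
    the truncated power basis. *)
Definition spline_poly theta l : {poly R} :=
  \poly_(j < k.+1) ext0 theta j +
  \sum_(0 <= i < l) ext0 theta (i + k.+1) *: ('X - (t i)%:P) ^+ k.

Definition spline_of theta x := (spline_poly theta (count (fun u => u <= x) T)).[x].

(** The constant value of the [k]th derivative on the piece of index [l]. *)
Definition spline_top theta l : R :=
  k`!%:R * (ext0 theta k + \sum_(0 <= i < l) ext0 theta (i + k.+1)).

Lemma size_spline_poly theta l : (size (spline_poly theta l) <= k.+1)%N.
Proof.
rewrite (leq_trans (size_polyD _ _)) // geq_max size_poly /=.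
rewrite (leq_trans (size_sum _ _ _)) //; apply/bigmax_leqP_seq => i _ _.
by rewrite (leq_trans (size_scale_leq _ _)) // size_exp_XsubC.
Qed.

Lemma derivn_power_knot c a d : (d < k)%N ->
  (derivn d (c *: ('X - a%:P) ^+ k : {poly R})).[a] = 0.
Proof.
move=> dk; rewrite derivnZ hornerZ derivn_expXsubC hornerMn horner_exp !hornerE subrr expr0n.
have -> : (k - d == 0)%N = false by lia.
by rewrite mul0rn mulr0.
Qed.

Lemma spline_polyS theta l : spline_poly theta l.+1 =
  spline_poly theta l + ext0 theta (l + k.+1) *: ('X - (t l)%:P) ^+ k.
Proof. by rewrite /spline_poly big_nat_recr //= addrA. Qed.

Lemma spline_of_splines theta : splines k T (spline_of theta).
Proof.
exists (spline_poly theta); split=> // [l|l d]; first exact: size_spline_poly.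
rewrite size_knots => lm dk; rewrite nth_knots // spline_polyS derivnD hornerD.
by rewrite derivn_power_knot // addr0.
Qed.

(** Consecutive pieces agree at their knot up to order [k - 1], so they differ by
    a multiple of a [k]th power ([poly_power_of_flat]). *)
Lemma spline_coordinates f : splines k T f ->
  exists theta, forall x, 0 <= x <= 1 -> f x = spline_of theta x.
Proof.
move=> [p [sp dp fp]].
pose theta : 'cV[R]_n := \col_j (if (j <= k)%N then (p 0%N)`_j
   else (p (j - k.+1).+1 - p (j - k.+1)%N)`_k).
have pE l : (l <= m)%N -> p l = spline_poly theta l.
  elim: l => [_|l IH lm].
    rewrite /spline_poly big_geq // addr0; apply/polyP => j; rewrite coef_poly.
    case: ltnP => jk; last by rewrite (leq_sizeP _ _ (sp 0%N)).
    have jn : (j < n)%N by lia.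
    by rewrite (ext0E theta (Ordinal jn)) mxE /= -ltnS jk.
  rewrite spline_polyS -IH ?(ltnW lm) //; apply/eqP; rewrite addrC -subr_eq; apply/eqP.
  have jn : (l + k.+1 < n)%N by lia.
  rewrite (ext0E theta (Ordinal jn)) mxE /= ifF; last lia.
  rewrite addnK; apply: poly_power_of_flat.
    by rewrite (leq_trans (size_polyD _ _)) // size_polyN geq_max !sp.
  move=> d dk; rewrite derivnB hornerD hornerN -!nth_knots //.
  by rewrite dp ?subrr ?size_knots.
exists theta => x x01; rewrite fp // pE //.
by rewrite -size_knots; exact: count_size.
Qed.

Lemma sum_count (F : nat -> R) x :
  \sum_(0 <= i < count (fun u => u <= x) T) F i =
  \sum_(0 <= i < m) F i * (t i <= x)%R%:R.
Proof.
rewrite (big_nat_widen _ _ m) /=; last by rewrite -size_knots; exact: count_size.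
rewrite big_mkcond; apply: eq_big_nat => i /andP[_ im]; rewrite knots_count //.
by case: ifP => _; rewrite ?mulr1 ?mulr0.
Qed.

Lemma spline_ofE theta x : spline_of theta x =
  \sum_(j < k.+1) ext0 theta j * x ^+ j +
  \sum_(0 <= i < m) ext0 theta (i + k.+1) * (x - t i) ^+ k * (t i <= x)%R%:R.
Proof.
rewrite /spline_of /spline_poly hornerD horner_poly horner_sum; congr (_ + _).
rewrite -(sum_count (fun i => ext0 theta (i + k.+1) * (x - t i) ^+ k)).
by apply: eq_bigr => i _; rewrite hornerZ horner_exp !hornerE.
Qed.

Lemma spline_of_input theta (i : 'I_n) :
  spline_of theta (input R n i.+1) = (lars_basis R k n *m theta) i 0.
Proof.
rewrite spline_ofE mxE [RHS](bigID (fun j : 'I_n => (j <= k)%N)) /=; congr (_ + _).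
  rewrite (big_ord_widen n (fun j => ext0 theta j * input R n i.+1 ^+ j)); last lia.
  apply: eq_big => j; first by rewrite ltnS.
  rewrite ltnS => jk; rewrite ext0E !mxE /lars_entry !ltnS jk subSS subn0.
  case: eqP => [k0|_]; last by rewrite /input expr_div_n mulrC.
  have -> : nat_of_ord j = 0%N by lia.
  by rewrite ltn0 expr0 mulr1 mul1r.
transitivity (\sum_(j < n | (k < j)%N) lars_entry R k n i.+1 j.+1 * ext0 theta j); last first.
  by apply: eq_big => j; rewrite ?ltnNge // => _; rewrite ext0E mxE.
transitivity (\sum_(0 + k.+1 <= j < n) lars_entry R k n i.+1 j.+1 * ext0 theta j); last first.
  exact: (big_geq_mkord _ _ xpredT (fun j => lars_entry R k n i.+1 j.+1 * ext0 theta j)).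
rewrite big_addn; apply: eq_big_nat => l /andP[_ lm].
rewrite -mulrA mulrC; congr (_ * _).
rewrite /t input_le; case: (posnP k) => [k0|k0].
  rewrite /lars_entry k0 /= expr0 mul1r.
  by case: ltnP => h; [rewrite leqNgt (_ : (_ < _)%N) //|rewrite (_ : (_ <= _)%N) //]; lia.
rewrite lars_entry_trunc //; last lia.
set b := (k - uphalf k + 2 + l)%N.
have -> : ((l + k.+1).+1 - uphalf k = b)%N by rewrite /b; lia.
case: ltngtP => bi; rewrite ?mulr0 ?mulr1 ?mul0r //.
  by rewrite -mulrBl -natrB ?(ltnW bi) // expr_div_n.
by rewrite bi subrr expr0n eqn0Ngt k0.
Qed.

Lemma derivn_spline_poly theta l : derivn k (spline_poly theta l) = (spline_top theta l)%:P.
Proof.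
elim: l => [|l IH]; last first.
  rewrite spline_polyS derivnD IH derivnZ derivn_expXsubC subnn expr0 ffactnn.
  rewrite /spline_top big_nat_recr //= addrA [in RHS]mulrDr polyCD; congr (_ + _).
  by rewrite -(rmorph_nat polyC) -mul_polyC -polyCM mulrC.
rewrite /spline_poly /spline_top !big_geq // !addr0; apply/polyP => j.
rewrite coef_derivn coef_poly coefC; case: j => [|j] /=.
  by rewrite addn0 leqnn ffactnn mulr_natl.
by rewrite ifF ?mul0rn // ; lia.
Qed.

(** On the unit interval a spline is the sum of its first piece, truncated at 0,
    and of the [k]th powers truncated at the knots, to which
    [weak_derivative_sum] applies. *)
Lemma kth_derivative_spline_of theta f : (forall x, 0 <= x <= 1 -> f x = spline_of theta x) ->
  forall x, 0 <= x <= 1 ->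
  kth_derivative k f x = spline_top theta (count (fun u => u <= x) T).
Proof.
move=> fE; have [k0|k0] := posnP k.
  (* For [k = 0] the derivative is the function itself; the last knot
     is then 1, and the jump there counts. *)
  have D0 (p : {poly R}) : derivn k p = p by rewrite k0.
  move=> x x01; rewrite /kth_derivative {1}k0 /= fE // /spline_of.
  by rewrite -[X in X.[x]]D0 derivn_spline_poly hornerC.
apply: kth_derivative_eq => //; last 2 first.
- by move=> x _; exact: step_cvg_right.
- by apply: step_cvg_left => u uT; exact: knots_lt1.
(* [Q] and [tt] list the first piece, with 0 as its knot, before the others. *)
pose Q l := if l is l'.+1 then ext0 theta (l' + k.+1) *: ('X - (t l')%:P) ^+ k
  else spline_poly theta 0.
pose tt l := if l is l'.+1 then t l' else 0.
have tele (D : {linear {poly R} -> {poly R}}) x : 0 < x < 1 ->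
    \sum_(0 <= l < m.+1) trunc_poly (D (Q l)) (tt l) x =
    (D (spline_poly theta (count (fun u => u <= x) T))).[x].
  move=> /andP[x0 _]; rewrite big_nat_recl //= {1}/trunc_poly (ltW x0) mulr1.
  rewrite -(sum_count (fun i => (D (ext0 theta (i + k.+1) *: ('X - (t i)%:P) ^+ k)).[x])).
  rewrite -horner_sum -hornerD -raddf_sum -raddfD /=.
  by rewrite /spline_poly [X in _ + X + _]big_geq // addr0.
apply: (@weak_derivative_ext _ _ (fun x => \sum_(0 <= l < m.+1) trunc_poly (Q l) (tt l) x) _
   (fun x => \sum_(0 <= l < m.+1) trunc_poly (derivn k (Q l)) (tt l) x)).
- move=> x x01; rewrite fE; last by case/andP: x01 => *; rewrite !ltW.
  exact: (tele idfun).
- by move=> x x01; rewrite (tele (derivn k)) //= derivn_spline_poly hornerC.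
apply: weak_derivative_sum => -[_|l lm] /=; first by rewrite lexx ltr01; split=> //; left.
have tT : t l \in T by rewrite -nth_knots // mem_nth // size_knots.
split; first by rewrite (ltW (knots_gt0 tT)) knots_lt1.
by right => d dk; exact: derivn_power_knot.
Qed.

(** The truncated powers are not divided by [k!], so each jump of the [k]th
    derivative is [k!] times a coordinate. *)
Lemma lars_obj_lasso theta f (y : 'cV[R]_n) lambda :
  (forall x, 0 <= x <= 1 -> f x = spline_of theta x) ->
  lars_obj k y lambda f = (lasso_obj k (lars_basis R k n) y (lambda * k`!%:R) theta)%:E.
Proof.
move=> fE; rewrite /lars_obj (total_variation_step (T := T) (c := spline_top theta)) //.
- rewrite -EFinM -EFinD /lasso_obj; congr (_ + _)%:E.
    congr (_ * _); apply: eq_bigr => i _; rewrite fE ?spline_of_input //.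
    by rewrite -input0 -inputn !input_le /=.
  rewrite -mulrA; congr (_ * _); rewrite size_knots.
  transitivity (\sum_(0 <= l < m) k`!%:R * `|ext0 theta (l + k.+1)|).
    apply: eq_bigr => l _; rewrite /spline_top big_nat_recr //= -mulrBr.
    rewrite [X in _ * X](_ : _ = ext0 theta (l + k.+1)); last by ring.
    by rewrite normrM normr_nat.
  rewrite -mulr_sumr; congr (_ * _).
  rewrite -(sum_iter_predn k.+1 n (fun l => `|ext0 theta (l + k.+1)|)).
  rewrite (sum_diff_rows k.+1 n (fun l => `|ext0 theta l|)).
  by apply: eq_bigr => j _; rewrite ext0E.
- exact: knots_path.
- exact: knots_le1.
- exact: kth_derivative_spline_of.
Qed.

Lemma lars_estimate_lasso (y : 'cV[R]_n) lambda f : lars_estimate k y lambda f ->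
  exists2 theta, argmin setT (lasso_obj k (lars_basis R k n) y (lambda * k`!%:R)) theta &
    forall i : 'I_n, f (input R n i.+1) = (lars_basis R k n *m theta) i 0.
Proof.
move=> [/spline_coordinates [theta fE] mf]; exists theta.
  split=> // s _; have := mf _ (spline_of_splines s).
  by rewrite (lars_obj_lasso y lambda fE) (lars_obj_lasso y lambda (fun x _ => erefl)) lee_fin.
by move=> i; rewrite fE ?spline_of_input // -input0 -inputn !input_le /=.
Qed.

End SplineCoordinates.

(** * The comparison *)

Theorem lemma3 (R : realType) (k n : nat) (hn : (k + 2 <= n)%N) :
  let G := lars_basis R k n in
  let H := tf_basis R k n in
  (k = 0%N \/ k = 1%N ->
     G = H /\
     forall (y : 'cV[R]_n) (lambda : R), 0 <= lambda ->
       [/\ forall theta, lasso_obj k G y lambda theta =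
                         lasso_obj k H y lambda theta,
           argmin setT (lasso_obj k G y lambda) =
             argmin setT (lasso_obj k H y lambda)
         & forall (beta : 'cV[R]_n) (f : R -> R),
             tf_estimate k y lambda beta -> lars_estimate k y lambda f ->
             forall i : 'I_n, beta i 0 = f (input R n i.+1)])
  /\
  ((2 <= k)%N ->
     [/\ G <> H,
         forall (y : 'cV[R]_n) (lambda : R), 0 <= lambda ->
           exists theta, lasso_obj k G y lambda theta <>
                         lasso_obj k H y lambda theta
       & generically (fun y : 'cV[R]_n =>
           exists2 lambda0 : R, 0 < lambda0 &
           forall lambda : R, 0 < lambda < lambda0 ->
             (forall theta alpha : 'cV[R]_n,
                argmin setT (lasso_obj k G y lambda) theta ->
                argmin setT (lasso_obj k H y lambda) alpha ->
                G *m theta <> H *m alpha) /\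
             (forall (beta : 'cV[R]_n) (f : R -> R),
                tf_estimate k y lambda beta -> lars_estimate k y lambda f ->
                exists i : 'I_n, beta i 0 <> f (input R n i.+1)))]).
Proof.
move=> G H.
have kn : (k < n)%N by lia.
split=> [k01|k2].
  have GH : G = H by exact: lars_tf_basis_eq.
  split=> // y lambda l0; rewrite -GH; split=> // beta f tfb larsf i.
  have [alpha -> ma] := tf_estimate_lasso kn tfb.
  have [theta mt ->] := lars_estimate_lasso hn larsf.
  have kf : k`!%:R = 1 :> R by case: k01 => ->.
  have ma' : argmin setT (lasso_obj k G y lambda) alpha by rewrite GH.
  have mt' : argmin setT (lasso_obj k G y lambda) theta.
    by move: mt; rewrite kf mulr1.
  by rewrite -/H -/G -GH (lasso_fit_unique l0 ma' mt').
split.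
- move=> GH; have [theta] := lasso_objs_differ (0 : 'cV[R]_n) 0 k2 hn.
  by apply; rewrite -/G GH.
- by move=> y lambda _; exact: lasso_objs_differ.
have [a a0 aP] := @fits_differ R _ _ k2 hn.
exists [:: a]; split; first by move=> b; rewrite inE => /eqP ->.
move=> y /(_ a (mem_head _ _)) /aP [lambda0 l0 l0P].
exists lambda0 => // lambda lP; have lpos : 0 < lambda by case/andP: lP.
split=> [theta alpha mt ma|beta f tfb larsf].
  by apply: (l0P _ lP lambda) mt => //; exact: lasso_tf_estimate.
have [theta mt fE] := lars_estimate_lasso hn larsf.
apply: contrapT => /forallNP eqf; have ll' : lambda <= lambda * k`!%:R.
  by rewrite ler_peMr ?ler1n ?fact_gt0 // ltW.
apply: (l0P _ lP _ _ _ ll' tfb mt); apply/matrixP => i j; rewrite ord1 -fE.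
by have /contrapT -> := eqf i.
Qed.
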